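(* If $cov(v^0) = \omega_1$, then the ideal $(v^0)$ has the ideal type $(\mathfrak{c}, \omega_1, \mathfrak{c})$.
   Context: $[\omega]^\omega$ is the family of all infinite subsets of $\omega$; $\mathfrak{c}$ is the cardinality of the continuum. For $A \subseteq B \subseteq \omega$ with $B\setminus A$ infinite, the set $\langle A,B\rangle = \{X \in [\omega]^\omega : A \subseteq X \subseteq B\}$ is called a segment. A set $S \subseteq [\omega]^\omega$ is a $v^0$-set if for each segment $\langle A,B\rangle$ there is a segment $\langle C,D\rangle \subseteq \langle A,B\rangle$ with $\langle C,D\rangle \cap S = \emptyset$. The family of all $v^0$-sets is a $\sigma$-ideal, denoted $(v^0)$, with $\bigcup (v^0) = [\omega]^\omega$. $cov(v^0) = \min\{|\mathcal{F}| : \mathcal{F} \subseteq (v^0) \text{ and } \bigcup\mathcal{F} = [\omega]^\omega\}$. Let $\mathcal{I}$ be a proper ideal on the set $\bigcup\mathcal{I}$ and let $\kappa$ be a cardinal. A collection of families $\mathcal{H} = \{\mathcal{P}_\alpha : \alpha < \kappa\}$ is called a base $\mathcal{I}$-matrix if: (1) each family $\mathcal{P}_\alpha$ consists of pairwise disjoint subsets of $\bigcup\mathcal{I}$; (2) if $\beta < \alpha$, then $\mathcal{P}_\alpha$ refines $\mathcal{P}_\beta$ (each member of $\mathcal{P}_\alpha$ is contained in a member of $\mathcal{P}_\beta$); (3) $\bigcup\mathcal{I} \setminus \bigcup\mathcal{P}_\alpha \in \mathcal{I}$ for every $\alpha$; (4) $\mathcal{I}$ is the ideal of nowhere dense sets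 with respect to the topology on $\bigcup\mathcal{I}$ generated by $\bigcup\mathcal{H} = \bigcup_{\alpha<\kappa}\mathcal{P}_\alpha$. The ideal $\mathcal{I}$ has the ideal type $(\lambda, \kappa, \gamma)$ if there exists a base $\mathcal{I}$-matrix $\mathcal{H} = \{\mathcal{P}_\alpha : \alpha < \kappa\}$ such that: (5) each $\mathcal{P}_\alpha$ has cardinality $\lambda$; (6) if $\beta < \alpha$ and $X \in \mathcal{P}_\beta$, then $X \setminus \bigcup\mathcal{P}_\alpha$ has cardinality $\gamma$; (7) if $\beta < \alpha$ and $Y \in \mathcal{P}_\beta$, then $Y$ contains $\lambda$ many members of $\mathcal{P}_\alpha$; (8) if $\mathcal{C} \subseteq \bigcup\mathcal{H}$ is a maximal chain (with respect to inclusion), then $\mathcal{C} \cap \mathcal{P}_\alpha$ is nonempty for each $\alpha < \kappa$; (9) $\bigcap\{\bigcup\mathcal{P}_\alpha : \alpha < \kappa\} = \emptyset$. *)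

(* Defs.v *)
From HB Require Import structures.
From mathcomp Require Import all_boot.
From mathcomp Require Import boolp classical_sets functions cardinality wochoice.
From mathcomp Require Import filter topology.

Set Implicit Arguments.
Unset Strict Implicit.
Unset Printing Implicit Defensive.

Local Open Scope classical_set_scope.
Local Open Scope card_scope.

Definition below (T : Type) (R : rel T) (a : T) : set T :=
  [set b | R b a /\ b <> a].

(* A cardinal, used as an index set, is an initial ordinal: a well-ordered type
   that does not inject into any of its proper initial segments. *)
Record cardinal := Cardinal {
  ordinal_sort :> Type;
  ordinal_le : rel ordinal_sort;
  ordinal_well_order : well_order ordinal_le;
  ordinal_initial : forall a : ordinal_sort,
    ~ ([set: ordinal_sort] #<= below ordinal_le a) }.

Definition ordinal_lt (k : cardinal) (b a : k) : Prop :=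
  below (@ordinal_le k) a b.

(* omega_1 is realised as the set of the points of a well-ordering of the
   uncountable type [set nat] that have only countably many predecessors;
   [omega1_below_countable] and [omega1_uncountable] characterise it. *)

Definition powerset_nat_le : rel (set nat) :=
  sval (well_ordering_principle (set nat)).

Definition omega1_sort : Type :=
  {x : set nat | countable (below powerset_nat_le x)}.

Definition omega1_le : rel omega1_sort :=
  fun x y => powerset_nat_le (sval x) (sval y).

Lemma powerset_nat_well_order : well_order powerset_nat_le.
Proof. exact: svalP (well_ordering_principle (set nat)). Qed.

Lemma omega1_sort_inj (x y : omega1_sort) : sval x = sval y -> x = y.
Proof.
by case: x y => [x px] [y py] /= xy; subst y; rewrite (Prop_irrelevance px py).
Qed.

Lemma omega1_well_order : well_order omega1_le.
Proof.
move=> A [w Aw].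
pose B : {pred set nat} := fun x => `[< exists2 w, sval w = x & w \in A >].
have [|x [[xB xmin] xuniq]] := powerset_nat_well_order (A := B).
  by exists (sval w); apply/asboolP; exists w.
have [m mx Am] := asboolP _ xB.
exists m; split; first split=> // v Av.
  by rewrite /omega1_le mx; apply: xmin; apply/asboolP; exists v.
move=> v [Av vmin]; apply: omega1_sort_inj; rewrite mx; apply: xuniq; split.
  by apply/asboolP; exists v.
by move=> y /asboolP[u <- Au]; exact: vmin.
Qed.

Lemma omega1_below_countable (a : omega1_sort) : countable (below omega1_le a).
Proof.
have inj : {in below omega1_le a &, injective (fun x : omega1_sort => sval x)}.
  by move=> x y _ _; exact: omega1_sort_inj.
rewrite /countable -(card_le_eql (inj_card_eq inj)).
apply: sub_countable (svalP a); apply: subset_card_le => _ [x [xa ne] <-].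
by split=> // /omega1_sort_inj.
Qed.

Lemma set_nat_uncountable : ~ countable [set: set nat].
Proof.
move=> /countable_injP[f]; set g := (f : set nat -> nat) => ginj.
have finj (x y : set nat) : g x = g y -> x = y.
  by move=> e; apply: ginj; rewrite ?inE.
pose D := [set n | exists2 X, g X = n & ~ X n].
have [DgD|nDgD] := pselect (D (g D)); last by apply: (nDgD); exists D.
by have [X /finj XD] := DgD; rewrite XD.
Qed.

Lemma omega1_uncountable : ~ countable [set: omega1_sort].
Proof.
move=> c1; apply: set_nat_uncountable.
pose W := [set x : set nat | countable (below powerset_nat_le x)].
have cW : countable W.
  apply: sub_countable c1; apply: card_le_trans (card_image_le sval _).
  by apply: subset_card_le => x Wx; exists (exist _ x Wx).
suff WT x : W x.
  by apply: sub_countable cW; apply: subset_card_le => x _; exact: WT.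
apply: contrapT => nWx.
pose B : {pred set nat} := fun y => `[< ~ W y >].
have [|m [[mB mmin] _]] := powerset_nat_well_order (A := B).
  by exists x; apply/asboolP.
have nWm := asboolP _ mB; apply: (nWm); rewrite /W /=.
apply: sub_countable cW; apply: subset_card_le => y [ym ne].
apply: contrapT => nWy; apply: ne.
have wo : wo_chain powerset_nat_le predT.
  by move=> A _; exact: powerset_nat_well_order.
have anti := wo_chain_antisymmetric wo.
by apply: anti => //; rewrite ym mmin //; apply/asboolP.
Qed.

Lemma omega1_initial (a : omega1_sort) :
  ~ ([set: omega1_sort] #<= below omega1_le a).
Proof.
move=> le; apply: omega1_uncountable.
exact: sub_countable le (omega1_below_countable a).
Qed.

Definition omega1 : cardinal := Cardinal omega1_well_order omega1_initial.

Definition infsets : set (set nat) := [set X | infinite_set X].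

Definition segment (A B : set nat) : set (set nat) :=
  [set X | [/\ infsets X, A `<=` X & X `<=` B]].

(* the pairs (A, B) to which the notion of a segment applies *)
Definition segment_pair (A B : set nat) : Prop :=
  A `<=` B /\ infinite_set (B `\` A).

Definition v0 : set (set (set nat)) :=
  [set S | S `<=` infsets /\
    forall A B, segment_pair A B ->
      exists C D, [/\ segment_pair C D, segment C D `<=` segment A B &
        segment C D `&` S = set0]].

(* cov(v0) is the cardinality of the type [K]. *)
Definition cov_v0_eq (K : Type) : Prop :=
  (exists F : set (set (set nat)),
     [/\ F `<=` v0, \bigcup_(S in F) S = infsets & F #= [set: K]]) /\
  forall F : set (set (set nat)),
    F `<=` v0 -> \bigcup_(S in F) S = infsets -> [set: K] #<= F.

Definition ground (T : Type) (I : set (set T)) : set T := \bigcup_(A in I) A.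

Definition proper_ideal (T : Type) (I : set (set T)) : Prop :=
  [/\ I set0,
      forall A B, I B -> A `<=` B -> I A,
      forall A B, I A -> I B -> I (A `|` B) &
      ~ I (ground I)].

(* The set [E], as a type, with the topology generated by the traces on [E] of
   the members of [G] (as a subbase, so that [E] itself is open). *)
Definition generated_space (T : choiceType) (E : set T) (G : set (set T)) :
  Type := set_type E.

HB.instance Definition _ (T : choiceType) (E : set T) (G : set (set T)) :=
  Choice.on (generated_space E G).

HB.instance Definition _ (T : choiceType) (E : set T) (G : set (set T)) :=
  isSubBaseTopological.Build (generated_space E G) G
    (fun A : set T => [set x : set_type E | A (val x)]).

Definition nowhere_dense (X : topologicalType) (A : set X) : Prop :=
  interior (closure A) = set0.

Definition nowhere_dense_ideal (T : choiceType) (E : set T) (G : set (set T)) :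
    set (set T) :=
  [set A | A `<=` E /\
    nowhere_dense [set x : generated_space E G | A (val (x : set_type E))]].

Section Matrix.
Variables (T : choiceType) (I : set (set T)) (k : cardinal).
Variable P : k -> set (set T).

Definition matrix_union : set (set T) := \bigcup_(a in [set: k]) P a.

Definition matrix_level (a : k) : set T := \bigcup_(X in P a) X.

Definition base_matrix : Prop :=
  [/\ forall a, (forall X, P a X -> X `<=` ground I) /\ trivIset (P a) id,
      forall b a, ordinal_lt b a ->
        forall X, P a X -> exists2 Y, P b Y & X `<=` Y,
      forall a, I (ground I `\` matrix_level a) &
      I = nowhere_dense_ideal (ground I) matrix_union].

End Matrix.

Definition maximal_chain (T : Type) (F C : set (set T)) : Prop :=
  [/\ C `<=` F, total_on C subset &
      forall D, D `<=` F -> total_on D subset -> C `<=` D -> D = C].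

(* The cardinals lambda and gamma are given by types of these cardinalities. *)
Definition ideal_type (T : choiceType) (I : set (set T))
    (lambda : Type) (k : cardinal) (gamma : Type) : Prop :=
  proper_ideal I /\
  exists P : k -> set (set T), base_matrix I P /\
    [/\ forall a, P a #= [set: lambda],
        forall b a, ordinal_lt b a -> forall X, P b X ->
          X `\` matrix_level P a #= [set: gamma],
        forall b a, ordinal_lt b a -> forall Y, P b Y ->
          [set X | P a X /\ X `<=` Y] #= [set: lambda],
        forall C, maximal_chain (matrix_union P) C ->
          forall a, C `&` P a !=set0 &
        \bigcap_(a in [set: k]) matrix_level P a = set0].

(* a type of cardinality the continuum *)
Definition continuum : Type := set nat.

(* Main.v *)
Require Import Defs.
From mathcomp Require Import all_boot.
From mathcomp Require Import boolp classical_sets cardinality.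
From mathcomp Require Import wochoice topology zify.

(* Segments are replaced by *-segments {X : A ⊆* X ⊆* B} (inclusions modulo
   finite sets): by a fusion argument, S is a v0-set iff every *-segment contains
   one disjoint from S, and *-segments are closed under countable decreasing lower
   bounds. Let S_al (al < omega_1) be v0-sets covering the infinite sets. Level al
   consists of *-segments disjoint from S_al and lying below the earlier levels,
   chosen one by one along an initial well-order of type c: the t-th choice lies
   in the t-th *-segment and is disjoint from all the previous choices, if
   possible. Since fewer than c choices were made before, this succeeds as soon as
   the t-th *-segment contains c candidates such that no earlier choice meets two
   of them. This makes every level predense, although two *-segments can meet
   without having a common refinement. As no infinite set survives all levels,
   every *-segment x splits at some level; iterating gives a binary tree below x
   with c branches, separated at any level al above those involved, so that the
   choice made at level al for x succeeds: x contains a member of the matrix. *)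

Set Implicit Arguments.
Unset Strict Implicit.
Unset Printing Implicit Defensive.

Local Open Scope classical_set_scope.
Local Open Scope card_scope.

(** * Inclusion modulo finite sets, segments and *-segments *)

Definition almost_sub (A B : set nat) : Prop :=
  exists n, forall k, n <= k -> A k -> B k.

Local Notation "A `<=*` B" := (almost_sub A B) (at level 70).

Lemma infinite_natP (A : set nat) :
  infinite_set A <-> forall n, exists2 k, n <= k & A k.
Proof.
split=> [infA n|unb /finite_seqP[s As]].
  apply: contrapT => nA; apply: infA; apply: sub_finite_set (finite_II n) => k Ak /=.
  by rewrite ltnNge; apply/negP => nk; apply: nA; exists k.
have [k sk] := unb (\max_(i <- s) i).+1.
rewrite As /= => ks; suff : k <= \max_(i <- s) i by rewrite leqNgt sk.
exact: leq_bigmax_seq.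
Qed.

Lemma almost_subPn (A B : set nat) : ~ (A `<=*` B) <-> infinite_set (A `\` B).
Proof.
rewrite infinite_natP; split=> [nAB n|inf [n AB]].
  apply: contrapT => nk; apply: nAB; exists n => k nlek Ak.
  by apply: contrapT => nBk; apply: nk; exists k.
by have [k nk [Ak]] := inf n; apply; exact: AB.
Qed.

Lemma sub_almost_sub (A B : set nat) : A `<=` B -> A `<=*` B.
Proof. by move=> AB; exists 0 => k _; exact: AB. Qed.

Lemma almost_sub_refl (A : set nat) : A `<=*` A.
Proof. exact: sub_almost_sub. Qed.

Lemma almost_sub_trans (B A C : set nat) :
  A `<=*` B -> B `<=*` C -> A `<=*` C.
Proof.
move=> [m AB] [n BC]; exists (maxn m n) => k; rewrite geq_max => /andP[mk nk].
by move=> /(AB _ mk) /(BC _ nk).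
Qed.

Lemma almost_subU (A B C : set nat) :
  A `<=*` C -> B `<=*` C -> (A `|` B) `<=*` C.
Proof.
move=> [m AC] [n BC]; exists (maxn m n) => k; rewrite geq_max => /andP[mk nk].
by case=> [/(AC _ mk)|/(BC _ nk)].
Qed.

Lemma almost_subI (A B C : set nat) :
  C `<=*` A -> C `<=*` B -> C `<=*` (A `&` B).
Proof.
move=> [m AC] [n BC]; exists (maxn m n) => k; rewrite geq_max => /andP[mk nk].
by move=> Ck; split; [exact: AC|exact: BC].
Qed.

Lemma infinite_almost_sub (A B : set nat) :
  A `<=*` B -> infinite_set A -> infinite_set B.
Proof.
move=> [n AB] /infinite_natP infA; apply/infinite_natP => m.
have [k] := infA (maxn m n); rewrite geq_max => /andP[mk nk] Ak.
by exists k => //; exact: AB.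
Qed.

Lemma infinite_meet (A B : set nat) :
  infinite_set A -> A `<=*` B -> A `&` B !=set0.
Proof.
move=> infA AB; apply: infinite_setN0; apply: infinite_almost_sub infA.
exact: almost_subI (almost_sub_refl _) AB.
Qed.

Lemma infinite_enum (W : set nat) : infinite_set W ->
  exists b : nat -> nat, (forall i, W (b i)) /\ {homo b : i j / i < j}.
Proof.
move=> /infinite_natP infW.
have /choice[next nextP] : forall n, exists k, n <= k /\ W k.
  by move=> n; have [k] := infW n; exists k.
pose b := fix b n := if n is m.+1 then next (b m).+1 else next 0.
exists b; split; first by case=> [|i]; exact: (nextP _).2.
apply: homo_ltn => [j i k|i]; first exact: ltn_trans.
exact: (nextP _).1.
Qed.

Lemma homo_ltn_geq_id (b : nat -> nat) :
  {homo b : i j / i < j} -> forall i, i <= b i.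
Proof. by move=> bi; elim=> // i /leq_ltn_trans; apply; exact: bi. Qed.

Lemma homo_ltn_inj (b : nat -> nat) : {homo b : i j / i < j} -> injective b.
Proof.
move=> bi i j bij; case: (ltngtP i j) => // /bi; by rewrite bij ltnn.
Qed.

Lemma infinite_split (W : set nat) : infinite_set W ->
  exists V, [/\ V `<=` W, infinite_set V & infinite_set (W `\` V)].
Proof.
move=> /infinite_enum[b [Wb bi]].
have bge := homo_ltn_geq_id bi; have binj := homo_ltn_inj bi.
exists [set k | exists i, k = b i.*2]; split.
- by move=> _ [i ->].
- apply/infinite_natP => n; exists (b n.*2); last by exists n.
  by apply: leq_trans (bge _); rewrite -addnn leq_addr.
- apply/infinite_natP => n; exists (b n.*2.+1).
    by apply: leq_trans (bge _); rewrite -addnn; lia.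
  by split=> // -[i /binj]; lia.
Qed.

(** If one half [U] of [V] covers almost all of [W], then the other half misses almost all of
    [W]. *)
Lemma infinite_split2 (V W : set nat) : infinite_set V -> infinite_set W ->
  exists U, [/\ U `<=` V, infinite_set U & infinite_set (W `\` U)].
Proof.
move=> infV infW; have [U [UV infU infVU]] := infinite_split infV.
have [finWU|] := pselect (finite_set (W `\` U)); last by exists U.
exists (V `\` U); split=> //.
apply: sub_infinite_set (infinite_setD infW finWU).
move=> k [Wk nWUk]; split=> // -[_ nUk]; apply: nWUk; split=> //.
Qed.

Lemma segment_pair_widen (A B A' B' : set nat) : segment_pair A B ->
  A' `<=` B' -> A' `<=*` A -> B `<=*` B' -> segment_pair A' B'.
Proof.
move=> [_ infBA] A'B' [m A'A] [n BB']; split=> //.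
apply: infinite_almost_sub infBA; exists (maxn m n) => k.
rewrite geq_max => /andP[mk nk] [Bk nAk]; split; first exact: BB'.
by move=> /(A'A _ mk).
Qed.

(* [X] and [Y] pin down the end points of any segment containing [segment A B]. *)
Lemma segment_pair_split (A B : set nat) : segment_pair A B ->
  exists X Y, [/\ infinite_set (X `\` Y), infinite_set (Y `\` X),
    X `&` Y = A & X `|` Y = B].
Proof.
move=> [AB /infinite_split[W [WBA infW infBAW]]].
exists (A `|` W), (B `\` W); split.
- by apply: sub_infinite_set infW => k Wk; split=> [|[]]; first by right.
- by apply: sub_infinite_set infBAW => k [[Bk nAk] nWk]; split=> // -[].
- apply/seteqP; split=> k /=; first by move=> [[//|Wk] [_ /(_ Wk)]].
  by move=> Ak; split; [left|split; [exact: AB|move=> /WBA[_]; exact]].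
- apply/seteqP; split=> k /=; first by move=> [[/AB|/WBA[]]|[]].
  by move=> Bk; have [Wk|nWk] := pselect (W k); [left; right|right].
Qed.

Definition sseg (A B : set nat) : set (set nat) :=
  [set X | [/\ infinite_set X, A `<=*` X & X `<=*` B]].

Definition ssegs : set (set (set nat)) :=
  [set x | exists A B, segment_pair A B /\ x = sseg A B].

Lemma segment_sub_sseg (A B : set nat) : segment A B `<=` sseg A B.
Proof. by move=> X [infX AX XB]; split=> //; exact: sub_almost_sub. Qed.

Lemma ssegs_infsets (x : set (set nat)) : ssegs x -> x `<=` infsets.
Proof. by move=> [A [B [_ ->]]] X []. Qed.

Lemma sseg_sub (A B C D : set nat) :
  A `<=*` C -> D `<=*` B -> sseg C D `<=` sseg A B.
Proof.
by move=> AC DB X [infX CX XD]; split=> //;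
  [exact: almost_sub_trans CX|exact: almost_sub_trans DB].
Qed.

Lemma sseg_subP (A B C D : set nat) : segment_pair C D ->
  sseg C D `<=` sseg A B -> A `<=*` C /\ D `<=*` B.
Proof.
move=> /segment_pair_split[X [Y [infX infY <- <-]]] sub.
have inC Z : Z = X \/ Z = Y -> sseg (X `&` Y) (X `|` Y) Z.
  case=> ->; split; try (apply: sub_almost_sub => k; by [case|left|right]).
    by apply: sub_infinite_set infX => k [].
  by apply: sub_infinite_set infY => k [].
have [_ AX XB] := sub _ (inC X (or_introl erefl)).
have [_ AY YB] := sub _ (inC Y (or_intror erefl)).
by split; [exact: almost_subI|exact: almost_subU].
Qed.

Lemma segment_subP (A B C D : set nat) : segment_pair C D ->
  segment C D `<=` segment A B -> A `<=` C /\ D `<=` B.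
Proof.
move=> /segment_pair_split[X [Y [infX infY <- <-]]] sub.
have inC Z : Z = X \/ Z = Y -> segment (X `&` Y) (X `|` Y) Z.
  case=> ->; split; try (move=> k; by [case|left|right]).
    by apply: sub_infinite_set infX => k [].
  by apply: sub_infinite_set infY => k [].
have [_ AX XB] := sub _ (inC X (or_introl erefl)).
have [_ AY YB] := sub _ (inC Y (or_intror erefl)).
by split=> [k Ak|k []]; [split; [exact: AX|exact: AY]|exact: XB|exact: YB].
Qed.

(** * Avoiding a v0-set along all finite patterns *)

Definition agree_below (n : nat) (X Y : set nat) : Prop :=
  forall k, k < n -> (X k <-> Y k).

Definition between_from (n : nat) (A B X : set nat) : Prop :=
  forall k, n <= k -> (A k -> X k) /\ (X k -> B k).

(** Overwriting [A] and [B] by [s] below [n] gives a segment to which the v0 property applies; the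
    original values below [n] are restored afterwards. A member of [S] that follows [s] and lies
    between [C] and [D] from [n] on would belong to the segment found. *)
Lemma v0_avoid_pattern (S : set (set nat)) (n : nat) (s A B : set nat) :
  v0 S -> segment_pair A B -> exists C D, [/\ segment_pair C D,
    A `<=` C /\ D `<=` B, agree_below n C A /\ agree_below n D B &
    forall X, S X -> agree_below n X s -> between_from n C D X -> False].
Proof.
move=> [Sinf Sv0] AB; have subAB := AB.1.
pose patch (Y : set nat) := [set k | if k < n then s k else Y k].
have AB' : segment_pair (patch A) (patch B).
  apply: (segment_pair_widen AB).
  - by move=> k; rewrite /patch /=; case: ifP => // _; exact: subAB.
  - by exists n => k nk; rewrite /patch /= ltnNge nk.
  - by exists n => k nk; rewrite /patch /= ltnNge nk.
have [C [D [CD CDAB CDS]]] := Sv0 _ _ AB'; have subCD := CD.1.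
have [AC DB] := segment_subP CD CDAB.
pose unpatch (Y Z : set nat) := [set k | if k < n then Z k else Y k].
exists (unpatch C A), (unpatch D B); split.
- apply: (segment_pair_widen CD).
  + by move=> k; rewrite /unpatch /=; case: ifP => _; [exact: subAB|exact: subCD].
  + by exists n => k nk; rewrite /unpatch /= ltnNge nk.
  + by exists n => k nk; rewrite /unpatch /= ltnNge nk.
- split=> k; have := AC k; have := DB k; rewrite /patch /unpatch /=;
  by case: ifP => // _; auto.
- by split=> k kn; rewrite /unpatch /= kn.
- move=> X SX Xs XCD; suff : (segment C D `&` S) X by rewrite CDS.
  split=> //; split; first exact: Sinf.
  + move=> k Ck; case: (ltnP k n) => kn.
      by apply/Xs => //; have := DB _ (subCD _ Ck); rewrite /patch /= kn.
    by apply: (XCD k kn).1; rewrite /unpatch /= ltnNge kn.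
  + move=> k Xk; case: (ltnP k n) => kn.
      by apply/subCD/AC; rewrite /patch /= kn; apply/Xs.
    by have := (XCD k kn).2 Xk; rewrite /unpatch /= ltnNge kn.
Qed.

(* Deals, by induction on [m], with all [2 ^ m] patterns below [m] at once. *)
Lemma v0_avoid_patterns (S : set (set nat)) (n m : nat) (s A B : set nat) :
  v0 S -> m <= n -> segment_pair A B -> exists C D, [/\ segment_pair C D,
    A `<=` C /\ D `<=` B, agree_below n C A /\ agree_below n D B &
    forall X, S X -> (forall k, m <= k < n -> (X k <-> s k)) ->
      between_from n C D X -> False].
Proof.
move=> Sv0; elim: m s A B => [|m IH] s A B mn AB.
  by have [C [D ?]] := v0_avoid_pattern n s Sv0 AB; exists C, D.
(* The bit at [m] is now free: patterns with bit true are treated first, those with bit false inside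
   the result. *)
pose force (b : bool) := [set k | if k == m then (b : Prop) else s k].
have [C [D [CD [AC DB] [CA DBn] CDS]]] := IH (force true) _ _ (ltnW mn) AB.
have [E [F [EF [CE FD] [EC FDn] EFS]]] := IH (force false) _ _ (ltnW mn) CD.
exists E, F; split=> //.
- by split; [exact: subset_trans CE|exact: subset_trans DB].
- split=> k kn.
    by split=> [/(EC _ kn)/(CA _ kn)|/(CA _ kn)/(EC _ kn)].
  by split=> [/(FDn _ kn)/(DBn _ kn)|/(DBn _ kn)/(FDn _ kn)].
- move=> X SX Xs XEF; have [Xm|nXm] := pselect (X m).
    apply: (CDS X SX) => [k /andP[mk kn]|k nk].
      rewrite /force /=; case: eqP => [->|/eqP km]; first by split.
      by apply: Xs; rewrite ltn_neqAle eq_sym km mk.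
    have [EX XF] := XEF k nk; split=> [/CE /EX //|/XF /FD //].
  apply: (EFS X SX) => // k /andP[mk kn].
  rewrite /force /=; case: eqP => [->|/eqP km]; first by split.
  by apply: Xs; rewrite ltn_neqAle eq_sym km mk.
Qed.

Lemma v0_avoid_from (S : set (set nat)) (n : nat) (A B : set nat) :
  v0 S -> segment_pair A B -> exists C D, [/\ segment_pair C D,
    A `<=` C /\ D `<=` B, agree_below n C A /\ agree_below n D B &
    forall X, S X -> ~ between_from n C D X].
Proof.
move=> Sv0 AB.
have [C [D [? ? ? CDS]]] := v0_avoid_patterns set0 Sv0 (leqnn n) AB.
exists C, D; split=> // X SX; apply: CDS => // k.
by move=> /andP[nk kn]; move: (leq_trans kn nk); rewrite ltnn.
Qed.

(** * Fusion and the order of *-segments *)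

(* Fusion: at each step one element of [B `\` A] is kept alive and all the
   finite patterns below it are treated. *)
Lemma v0_avoid_almost (S : set (set nat)) (A B : set nat) :
  v0 S -> segment_pair A B -> exists C D, [/\ segment_pair C D,
    A `<=` C /\ D `<=` B & sseg C D `&` S = set0].
Proof.
move=> Sv0 AB0.
pose good (st st' : set nat * set nat * nat) :=
  let: (A, B, n) := st in let: (C, D, m) := st' in
  segment_pair A B -> [/\ segment_pair C D, A `<=` C /\ D `<=` B,
    agree_below m C A /\ agree_below m D B,
    exists2 k, n <= k < m & B k /\ ~ A k &
    forall X, S X -> ~ between_from m C D X].
have /choice[next nextP] : forall st, exists st', good st st'.
  move=> [[A' B'] n]; have [AB|nAB] := pselect (segment_pair A' B'); last first.
    by exists (A', B', n).
  have [k nk BAk] := (infinite_natP _).1 AB.2 n.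
  have [C [D [CD sub agr av]]] := v0_avoid_from k.+1 Sv0 AB.
  by exists (C, D, k.+1) => _; split=> //; exists k => //; rewrite nk leqnn.
pose st i := iter i next (A, B, 0).
pose a i := (st i).1.1; pose b i := (st i).1.2; pose n i := (st i).2.
have stP i : segment_pair (a i) (b i) -> [/\ segment_pair (a i.+1) (b i.+1),
    a i `<=` a i.+1 /\ b i.+1 `<=` b i,
    agree_below (n i.+1) (a i.+1) (a i) /\ agree_below (n i.+1) (b i.+1) (b i),
    exists2 k, n i <= k < n i.+1 & b i k /\ ~ a i k &
    forall X, S X -> ~ between_from (n i.+1) (a i.+1) (b i.+1) X].
  rewrite /a /b /n /=; have := nextP (st i).
  by case: (st i) => [[? ?] ?]; case: (next _) => [[? ?] ?].
have pairP i : segment_pair (a i) (b i) by elim: i => // i /stP[].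
have nlt i : n i < n i.+1.
  have [_ _ _ [k /andP[nk kn] _] _] := stP i (pairP i); exact: leq_ltn_trans kn.
have nge i : i <= n i by elim: i => // i /leq_ltn_trans; apply; exact: nlt.
have nle i j : i <= j -> n i <= n j.
  elim: j => [|j IH]; first by rewrite leqn0 => /eqP ->.
  rewrite leq_eqVlt => /predU1P[->//|]; rewrite ltnS => /IH /leq_trans; apply.
  exact: ltnW.
have mono i j : i <= j -> a i `<=` a j /\ b j `<=` b i.
  elim: j => [|j IH]; first by rewrite leqn0 => /eqP ->; split.
  rewrite leq_eqVlt => /predU1P[->|]; first by split.
  rewrite ltnS => /IH[aij bij].
  have [_ [aj bj] _ _ _] := stP j (pairP j).
  by split; [exact: subset_trans aj|exact: subset_trans bij].
have stable i j k : i <= j -> k < n i.+1 -> (a j k <-> a i k) /\ (b j k <-> b i k).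
  move=> + kn; elim: j => [|j IH]; first by rewrite leqn0 => /eqP ->; split.
  rewrite leq_eqVlt => /predU1P[->|]; first by split.
  rewrite ltnS => ij.
  have [<- <-] := IH ij; have [_ _ [aj bj] _ _] := stP j (pairP j).
  have knj : k < n j.+1 by apply: leq_trans kn (nle _ _ _).
  by split; [exact: aj|exact: bj].
(* Below [n i.+1] the limits agree with stage [i], so the element kept alive at stage [i] stays in
   [D] and outside [C]. *)
pose C := [set k | exists i, a i k]; pose D := [set k | forall i, b i k].
have ab i : a i `<=` b i := (pairP i).1.
exists C, D; split.
- split.
    move=> k [i aik] j; case: (leqP i j) => [ij|/ltnW ji].
      exact/ab/(mono _ _ ij).1.
    exact/(mono _ _ ji).2/ab.
  apply/infinite_natP => m.
  have [_ _ _ [k /andP[nk kn] [bk nak]] _] := stP m (pairP m).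
  exists k; first exact: leq_trans (nge m) nk.
  split.
    move=> j; case: (leqP m j) => [mj|/ltnW jm]; last exact: (mono _ _ jm).2.
    by apply/(stable m j k mj kn).2.
  move=> [j ajk]; apply: nak; case: (leqP m j) => [mj|/ltnW jm].
    by apply/(stable m j k mj kn).1.
  exact: (mono _ _ jm).1.
- split; first by move=> k Ak; exists 0.
  by move=> k /(_ 0).
- apply/seteqP; split=> // X [[_ [p CX] [q XD]] SX].
  (* [X] is between [C] and [D] from [maxn p q] on, and stage [(maxn p q).+1] has its threshold
     beyond this bound, so it excludes [X]. *)
  have [_ _ _ _ /(_ X SX)] := stP (maxn p q) (pairP _); apply=> k nk.
  have := leq_trans (leq_trans (leqnSn _) (nge _)) nk.
  rewrite geq_max => /andP[pk qk]; split=> [ak|Xk].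
    by apply: CX => //; eexists; exact: ak.
  exact: XD.
Qed.

Lemma v0_avoid (S x : set (set nat)) : v0 S -> ssegs x ->
  exists y, [/\ ssegs y, y `<=` x & y `&` S = set0].
Proof.
move=> Sv0 [A [B [AB ->]]].
have [C [D [CD [AC DB] CDS]]] := v0_avoid_almost Sv0 AB.
exists (sseg C D); split=> //; first by exists C, D.
by apply: sseg_sub; exact: sub_almost_sub.
Qed.

(** The end points of the *-segment found need not lie between [A] and [B]; clipping them to
    [A ∪ (B ∩ C)] and [A ∪ (B ∩ D)] alters them only finitely and gives a genuine segment. *)
Lemma v0_intro (S : set (set nat)) : S `<=` infsets ->
  (forall x, ssegs x -> exists y, [/\ ssegs y, y `<=` x & y `&` S = set0]) ->
  v0 S.
Proof.
move=> Sinf Sav; split=> // A B AB.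
have [_ [[C [D [CD ->]]] CDAB CDS]] := Sav _ (ex_intro _ A (ex_intro _ B (conj AB erefl))).
have [AC DB] := sseg_subP CD CDAB.
have ssub : sseg (A `|` (B `&` C)) (A `|` (B `&` D)) `<=` sseg C D.
  apply: sseg_sub.
    have CB : C `<=*` B by apply: almost_sub_trans DB; exact: sub_almost_sub CD.1.
    have := almost_subI CB (almost_sub_refl C) => /almost_sub_trans; apply.
    by apply: sub_almost_sub => k; right.
  apply: almost_subU; last by apply: sub_almost_sub => k [].
  exact: almost_sub_trans AC (sub_almost_sub CD.1).
exists (A `|` (B `&` C)), (A `|` (B `&` D)); split.
- apply: (segment_pair_widen CD).
  + by move=> k [Ak|[Bk Ck]]; [left|right; split=> //; exact: CD.1].
  + by apply: almost_subU => //; apply: sub_almost_sub => k [].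
  + have := almost_subI DB (almost_sub_refl D) => /almost_sub_trans; apply.
    by apply: sub_almost_sub => k; right.
- move=> X [infX AX XB]; split=> //.
    by move=> k Ak; apply: AX; left.
  by move=> k /XB[/AB.1|[]].
- apply/seteqP; split=> // X [/segment_sub_sseg/ssub CDX SX].
  by rewrite -CDS.
Qed.

(** [F n] and [G n], the union and intersection of the first end points, equal [A n] and [B n]
    modulo finite sets. Elements [b n] of the gaps, taken in increasing order, form a set [K] almost
    inside every [B n] and almost disjoint from every [A n]; it becomes the gap of the lower
    bound. *)
Lemma ssegs_lower_bound (x : nat -> set (set nat)) :
  (forall n, ssegs (x n)) -> (forall n, x n.+1 `<=` x n) ->
  exists2 y, ssegs y & forall n, y `<=` x n.
Proof.
move=> xQ xdec; have /choice[A /choice[B ABP]] := xQ.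
have xE n : x n = sseg (A n) (B n) := (ABP n).2.
have sub n : A n `<=*` A n.+1 /\ B n.+1 `<=*` B n.
  by apply: sseg_subP (ABP _).1 _; rewrite -!xE.
have AB n : A n `<=` B n := (ABP n).1.1.
pose F n := [set k | exists2 i, i <= n & A i k].
pose G n := [set k | forall i, i <= n -> B i k].
have FA n : F n `<=*` A n.
  elim: n => [|n IH].
    by apply: sub_almost_sub => k [i]; rewrite leqn0 => /eqP ->.
  apply: (@almost_sub_trans (F n `|` A n.+1)).
    apply: sub_almost_sub => k [i]; rewrite leq_eqVlt => /predU1P[->|]; first by right.
    by rewrite ltnS => ile Ai; left; exists i.
  apply: almost_subU; last exact: almost_sub_refl.
  exact: almost_sub_trans IH (sub n).1.
have BG n : B n `<=*` G n.
  elim: n => [|n IH].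
    by apply: sub_almost_sub => k Bk i; rewrite leqn0 => /eqP ->.
  apply: (@almost_sub_trans (G n `&` B n.+1)).
    apply: almost_subI; last exact: almost_sub_refl.
    exact: almost_sub_trans (sub n).2 IH.
  apply: sub_almost_sub => k [Gk Bk] i; rewrite leq_eqVlt => /predU1P[->//|].
  by rewrite ltnS; exact: Gk.
have /choice[next nextP] : forall nm, exists k, nm.2 <= k /\ (G nm.1 `\` F nm.1) k.
  move=> [n m] /=; have infGF : infinite_set (G n `\` F n).
    have [p Fp] := FA n; have [q Gq] := BG n.
    apply: infinite_almost_sub (ABP n).1.2; exists (maxn p q) => k.
    rewrite geq_max => /andP[pk qk] [Bk nAk]; split; first exact: Gq.
    by move=> /(Fp _ pk).
  by have [k] := (infinite_natP _).1 infGF m; exists k.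
pose b := fix b n := if n is m.+1 then next (n, (b m).+1) else next (0, 0).
have bP n : G n (b n) /\ ~ F n (b n) by case: n => [|n];
  [have [] := nextP (0, 0)|have [] := nextP (n.+1, (b n).+1)].
have bi : {homo b : i j / i < j}.
  apply: homo_ltn => [j i k|i]; first exact: ltn_trans.
  by have [] := nextP (i.+1, (b i).+1).
pose K := [set k | exists i, k = b i].
(* Cutting [A n] down to [G n] keeps the union almost inside every [B n]; removing [K] costs each
   [A n] only finitely many elements. *)
pose C := [set k | exists n, A n k /\ G n k] `\` K.
have KP n k : b n <= k -> K k -> B n k /\ ~ A n k.
  move=> bk [i kE]; have ni : n <= i.
    by rewrite leqNgt; apply/negP => /bi; rewrite -kE ltnNge bk.
  have [Gb nFb] := bP i; rewrite kE; split; first exact: Gb.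
  by move=> Ab; apply: nFb; exists n.
exists (sseg C (C `|` K)).
  exists C, (C `|` K); split=> //; split; first by left.
  apply/infinite_natP => n; exists (b n); first exact: homo_ltn_geq_id.
  by split=> [|[_]]; [right; exists n|apply; exists n].
move=> n; rewrite xE; apply: sseg_sub.
  have [m BGm] := BG n; exists (maxn m (b n)) => k.
  rewrite geq_max => /andP[mk bk] Ak; split.
    by exists n; split=> //; apply: BGm => //; exact: AB.
  by move=> /(KP n k bk)[].
apply: almost_subU; last by exists (b n) => k bk /(KP n k bk)[].
have [m FAm] := FA n; exists m => k mk [[i [Aik Gik]] _].
case: (leqP n i) => [ni|/ltnW ni]; first exact: Gik.
by apply/AB/FAm => //; exists i.
Qed.

(** * Compatibility and separation of *-segments *)

Definition compatible (x y : set (set nat)) : Prop :=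
  exists2 z, ssegs z & z `<=` x `&` y.

Lemma ssegs_almost_eq (x : set (set nat)) (X Y : set nat) :
  ssegs x -> X `<=*` Y -> Y `<=*` X -> x X -> x Y.
Proof.
move=> [A [B [_ ->]]] XY YX [infX AX XB]; split.
- exact: infinite_almost_sub infX.
- exact: almost_sub_trans XY.
- exact: almost_sub_trans XB.
Qed.

(* Two *-segments may meet without containing a common *-segment, but then their
   intersection is a single class modulo finite sets. *)
Lemma incompatible_almost_sub (x y : set (set nat)) (X Y : set nat) :
  ssegs x -> ssegs y -> ~ compatible x y -> (x `&` y) X -> (x `&` y) Y ->
  X `<=*` Y.
Proof.
move=> [A [B [AB ->]]] [C [D [CD ->]]] ncomp [[_ AX XB] [_ CX XD]].
move=> [[_ AY _] [_ CY _]].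
(* If [B ∩ D] is almost inside [A ∪ C], then [X ⊆* B ∩ D ⊆* A ∪ C ⊆* Y]; otherwise a common
   *-segment fits between [A ∪ C] and [B ∩ D]. *)
have [sub|/almost_subPn inf] := pselect ((B `&` D) `<=*` (A `|` C)).
  apply: almost_sub_trans (almost_subU AY CY).
  exact: almost_sub_trans (almost_subI XB XD) sub.
have lo : (A `|` C) `<=*` (B `&` D).
  exact: almost_sub_trans (almost_subU AX CX) (almost_subI XB XD).
case: ncomp; exists (sseg ((A `|` C) `&` (B `&` D)) (B `&` D)).
  exists ((A `|` C) `&` (B `&` D)), (B `&` D); split=> //; split; first by move=> k [].
  by apply: sub_infinite_set inf => k [BDk nk]; split=> // -[].
have lo' := almost_subI (almost_sub_refl _) lo.
move=> Z ZZ; split; apply: sseg_sub ZZ.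
- by apply: almost_sub_trans lo'; apply: sub_almost_sub => k; left.
- by apply: sub_almost_sub => k [].
- by apply: almost_sub_trans lo'; apply: sub_almost_sub => k; right.
- by apply: sub_almost_sub => k [].
Qed.

(** One of [C ⊆* A] and [B ⊆* D] fails: either an infinite part of [C \ A] is removed from the upper
    end, or an infinite part of [B \ D] is added to the lower end, chosen so that the gap stays
    infinite. *)
Lemma ssegs_separative (x y : set (set nat)) : ssegs x -> ssegs y ->
  ~ (x `<=` y) -> exists z, [/\ ssegs z, z `<=` x & z `&` y = set0].
Proof.
move=> [A [B [AB ->]]] [C [D [CD ->]]] nsub.
have [AC|/almost_subPn inf] := pselect (C `<=*` A).
  have /almost_subPn inf : ~ (B `<=*` D) by move=> BD; apply: nsub; exact: sseg_sub.
  have [U [UBD infU infBAU]] := infinite_split2 inf AB.2.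
  have BABU k : B k -> ~ A k -> ~ U k -> (B `\` (A `|` U)) k by move=> ? ? ?; split=> // -[].
  exists (sseg (A `|` U) B); split.
  - exists (A `|` U), B; split=> //; split; first by move=> k [/AB.1|/UBD[]].
    by apply: sub_infinite_set infBAU => k [[? ?] ?]; exact: BABU.
  - by apply: sseg_sub; apply: sub_almost_sub => k //; left.
  - apply/seteqP; split=> // X [[_ AUX _] [_ _ XD]].
    have UD : U `<=*` D.
      apply: almost_sub_trans XD; apply: almost_sub_trans AUX.
      by apply: sub_almost_sub => k; right.
    by have [k [/UBD[_ nDk] /nDk]] := infinite_meet infU UD.
have [U [UCA infU infBAU]] := infinite_split2 inf AB.2.
exists (sseg A (B `\` U)); split.
- exists A, (B `\` U); split=> //; split.
    by move=> k Ak; split; [exact: AB.1|move=> /UCA[_]].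
  by apply: sub_infinite_set infBAU => k [[Bk nAk] nUk].
- by apply: sseg_sub; apply: sub_almost_sub => // k [].
- apply/seteqP; split=> // X [[_ _ XBU] [_ CX _]].
  have UBU : U `<=*` (B `\` U).
    apply: almost_sub_trans XBU; apply: almost_sub_trans CX.
    by apply: sub_almost_sub => k /UCA[].
  by have [k [Uk [_ /(_ Uk)]]] := infinite_meet infU UBU.
Qed.

(** * Splitting a *-segment into continuum many parts *)

Lemma ssegs_split (x : set (set nat)) : ssegs x ->
  exists y z, [/\ ssegs y, ssegs z, y `<=` x, z `<=` x & y `&` z = set0].
Proof.
move=> [A [B [AB ->]]]; have [W [WBA infW infBAW]] := infinite_split AB.2.
exists (sseg (A `|` W) B), (sseg A (B `\` W)); split.
- exists (A `|` W), B; split=> //; split; first by move=> k [/AB.1|/WBA[]].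
  by apply: sub_infinite_set infBAW => k [[? ?] ?]; split=> // -[].
- exists A, (B `\` W); split=> //; split; last first.
    by apply: sub_infinite_set infBAW => k [[? ?] ?].
  by move=> k Ak; split; [exact: AB.1|move=> /WBA[_]].
- by apply: sseg_sub; apply: sub_almost_sub => k //; left.
- by apply: sseg_sub; apply: sub_almost_sub => // k [].
- apply/seteqP; split=> // X [[_ AWX _] [_ _ XBW]].
  have WBW : W `<=*` (B `\` W).
    apply: almost_sub_trans XBW; apply: almost_sub_trans AWX.
    by apply: sub_almost_sub => k; right.
  by have [k [Wk [_ /(_ Wk)]]] := infinite_meet infW WBW.
Qed.

Lemma ssegs_avoid_subsingleton (x N : set (set nat)) : ssegs x ->
  (forall X Y, (x `&` N) X -> (x `&` N) Y -> X = Y) ->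
  exists y, [/\ ssegs y, y `<=` x & y `&` N = set0].
Proof.
move=> xQ xN1; have [y [z [yQ zQ yx zx yz]]] := ssegs_split xQ.
have [yN|/set0P[X [yX NX]]] := eqVneq (y `&` N) set0; first by exists y.
exists z; split=> //; apply/seteqP; split=> // Y [zY NY].
rewrite -yz; split=> //.
by rewrite (xN1 Y X) //; split=> //; by [exact: zx|exact: yx].
Qed.

Definition agree_on (E X Y : set nat) : Prop :=
  exists n, forall k, n <= k -> E k -> (X k <-> Y k).

Lemma agree_on_sym (E X Y : set nat) : agree_on E X Y -> agree_on E Y X.
Proof. by move=> [n XY]; exists n => k nk Ek; apply: iff_sym; exact: XY. Qed.

Lemma agree_on_trans (E X Y Z : set nat) :
  agree_on E X Y -> agree_on E Y Z -> agree_on E X Z.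
Proof.
move=> [m XY] [n YZ]; exists (maxn m n) => k; rewrite geq_max => /andP[mk nk] Ek.
exact: iff_trans (XY k mk Ek) (YZ k nk Ek).
Qed.

(** For a *-segment with end points [A] and [B] this means that the gap [B \ A] meets [E] in a
    finite set only. *)
Definition decided (E : set nat) (x : set (set nat)) : Prop :=
  forall X Y, x X -> x Y -> agree_on E X Y.

Lemma decided_sub (E : set nat) (x y : set (set nat)) :
  y `<=` x -> decided E x -> decided E y.
Proof. by move=> yx Ex X Y /yx xX /yx xY; exact: Ex. Qed.

Lemma sseg_agree_on (E A B X : set nat) :
  (forall k, E k -> B k -> A k) -> sseg A B X -> agree_on E A X.
Proof.
move=> EBA [_ [m AX] [n XB]]; exists (maxn m n) => k.
rewrite geq_max => /andP[mk nk] Ek; split; first exact: AX.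
by move=> /(XB _ nk); exact: EBA.
Qed.

(** The gap is infinite on [E] or off [E]; shrinking it to such an infinite part freezes everything
    on the other side. *)
Lemma ssegs_decided (E : set nat) (x : set (set nat)) : ssegs x ->
  exists y, [/\ ssegs y, y `<=` x & decided E y \/ decided (~` E) y].
Proof.
move=> [A [B [AB ->]]].
have key F : infinite_set ((B `\` A) `&` F) ->
    exists y, [/\ ssegs y, y `<=` sseg A B & decided (~` F) y].
  move=> inf; pose D := A `|` ((B `\` A) `&` F).
  exists (sseg A D); split.
  - exists A, D; split=> //; split; first by left.
    by apply: sub_infinite_set inf => k [[Bk nAk] Fk]; split=> //; right.
  - apply: sseg_sub; apply: sub_almost_sub => // k [/AB.1//|[[]]//].
  - move=> X Y AX AY.
    have DA k : (~` F) k -> D k -> A k by move=> nFk [//|[_ /nFk]].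
    exact: agree_on_trans (agree_on_sym (sseg_agree_on DA AX)) (sseg_agree_on DA AY).
have [fin|inf] := pselect (finite_set ((B `\` A) `&` E)); last first.
  by have [y [? ? ?]] := key _ inf; exists y; split=> //; right.
have infC : infinite_set ((B `\` A) `&` ~` E).
  apply: sub_infinite_set (infinite_setD AB.2 fin) => k [BAk nE].
  by split=> // Ek; apply: nE.
have [y [? ? Ey]] := key _ infC; exists y; split=> //; left.
by rewrite setCK in Ey.
Qed.

Lemma ssegs_nonempty (x : set (set nat)) : ssegs x -> x !=set0.
Proof.
move=> [A [B [AB ->]]]; exists B; split; last exact: almost_sub_refl.
  by apply: sub_infinite_set AB.2 => k [].
exact: sub_almost_sub AB.1.
Qed.

Lemma ssegs_undecided (E : set nat) (x : set (set nat)) : ssegs x ->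
  decided E x -> decided (~` E) x -> False.
Proof.
move=> [A [B [AB ->]]]; have [X [Y [infXY infYX AXY BXY]]] := segment_pair_split AB.
have inX : sseg A B X.
  split; first by apply: sub_infinite_set infXY => k [].
  by rewrite -AXY; apply: sub_almost_sub => k [].
  by rewrite -BXY; apply: sub_almost_sub => k; left.
have inY : sseg A B Y.
  split; first by apply: sub_infinite_set infYX => k [].
  by rewrite -AXY; apply: sub_almost_sub => k [].
  by rewrite -BXY; apply: sub_almost_sub => k; right.
move=> /(_ X Y inX inY)[m EXY] /(_ X Y inX inY)[n nEXY].
apply: ((almost_subPn _ _).2 infXY); exists (maxn m n) => k.
rewrite geq_max => /andP[mk nk] Xk; have [Ek|nEk] := pselect (E k).
  exact/EXY.
exact/nEXY.
Qed.

(* The index [i] lies in column [logn 2 i.+1]: this splits [nat] into infinitely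
   many infinite columns. *)
Lemma logn2_column (c n : nat) : exists2 i, n <= i & logn 2 i.+1 = c.
Proof.
have pos : 0 < 2 ^ c * n.*2.+1 by rewrite muln_gt0 expn_gt0.
exists (2 ^ c * n.*2.+1).-1.
  rewrite -ltnS prednK //.
  by apply: leq_trans (leq_pmull _ _); [lia|rewrite expn_gt0].
rewrite prednK // lognM ?expn_gt0 // pfactorK // lognE dvdn2 /= odd_double.
by rewrite addn0.
Qed.

(* Requiring the members of the later levels below [x] to be in [d] makes them
   miss the points [pt f] of [x], and makes those compatible with different
   [part f] different. *)
Record splitter (x : set (set nat)) (d : set (set (set nat)))
    (pt : set nat -> set nat) (part : set nat -> set (set nat)) : Prop :=
  Splitter {
    splitter_down : forall y z, z `<=` y -> d y -> d z;
    splitter_dense : forall y, ssegs y -> exists z, [/\ ssegs z, z `<=` y & d z];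
    splitter_pt : forall f, x (pt f);
    splitter_pt_inj : injective pt;
    splitter_avoid : forall y f, d y -> ~ y (pt f);
    splitter_part : forall f, ssegs (part f) /\ part f `<=` x;
    splitter_part_disjoint : forall f g, part f `&` part g !=set0 -> f = g;
    splitter_one_part : forall y f g, d y ->
      compatible y (part f) -> compatible y (part g) -> f = g }.

(* Halve the free part of [x] by a set [E]: [d] asks that the members of a
   *-segment agree modulo finite sets on [E] or off [E]. The points [pt f] differ
   both on [E] and off [E], and [part f] fixes the trace of [pt f] on [E]. *)
Lemma splitter_exists (x : set (set nat)) : ssegs x ->
  exists d pt part, splitter x d pt part.
Proof.
move=> [A [B [AB ->]]]; have [b [bBA bi]] := infinite_enum AB.2.
have binj := homo_ltn_inj bi; have bge := homo_ltn_geq_id bi.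
have nAb j : ~ A (b j) := (bBA j).2.
pose E := [set k | exists i, k = b i.*2].
have Eb i : E (b i.*2) by exists i.
have nEb i : (~` E) (b i.*2.+1) by move=> [j /binj]; lia.
(* Column [c.+1] repeats the bit [f c] infinitely often, so it survives finite changes; column [0]
   is always full, which makes [pt f] infinite. Through [j./2], the same code is written on [E] and
   off [E]. *)
pose mem (f : set nat) c := if c is c'.+1 then f c' else True.
pose pt f := A `|` [set k | exists2 j, k = b j & mem f (logn 2 j./2.+1)].
have ptb f j : pt f (b j) <-> mem f (logn 2 j./2.+1).
  by split=> [[/nAb//|[i /binj ->//]]|m]; right; exists j.
have ptB f : pt f `<=` B by move=> k [/AB.1//|[j -> _]]; exact: (bBA j).1.
have pt_agree f g F : F = E \/ F = ~` E -> agree_on F (pt f) (pt g) -> f = g.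
  move=> FE [n fg]; apply/funext => c; apply/propext.
  have [i ni ic] := logn2_column c.+1 n.
  have [j [ji Fj]] : exists j, j./2 = i /\ F (b j).
    case: FE => ->; [exists i.*2|exists i.*2.+1]; split=> //.
      exact: doubleK.
    by rewrite /= uphalf_double.
  have nj : n <= b j by apply: leq_trans ni (leq_trans _ (bge j)); lia.
  by have := fg _ nj Fj; rewrite !ptb ji ic.
have pt_inf f : infinite_set (pt f).
  apply/infinite_natP => n; have [i ni ic] := logn2_column 0 n.
  exists (b i.*2); first by apply: leq_trans ni (leq_trans _ (bge _)); lia.
  by apply/ptb; rewrite doubleK ic.
(* On [E] both ends have the trace of [pt f]; the gap is the part of [B \ A] off [E]. *)
pose lo f := A `|` (pt f `&` E); pose up f := lo f `|` (B `&` ~` E).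
have loB f : lo f `<=` B by move=> k [/AB.1//|[/ptB]].
have upE f k : E k -> up f k -> lo f k by move=> Ek [//|[_ /(_ Ek)]].
have ptlo f : agree_on E (pt f) (lo f).
  by exists 0 => k _ Ek; split=> [pk|[Ak|[]//]]; [right|left].
pose part f := sseg (lo f) (up f).
have partE f X : part f X -> agree_on E (pt f) X.
  by move=> fX; exact: agree_on_trans (ptlo f) (sseg_agree_on (@upE f) fX).
have partQ f : ssegs (part f).
  exists (lo f), (up f); split=> //; split; first by left.
  apply/infinite_natP => n; exists (b n.*2.+1).
    by apply: leq_trans (bge _); lia.
  split; first by right; split; [exact: (bBA _).1|exact: nEb].
  by move=> [/nAb|[_ /nEb]].
pose d y := (decided E y \/ decided (~` E) y) /\ forall f, ~ y (pt f).
exists d, pt, part; split=> //.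
- move=> y z zy [dy ny]; split=> [|f /zy]; last exact: ny.
  by case: dy => dy; [left|right]; exact: decided_sub dy.
- move=> y yQ; have [z [zQ zy dz]] := ssegs_decided E yQ.
  (* A decided *-segment contains at most one [pt f], since distinct ones differ infinitely often on
     [E] and off [E]. *)
  have [|w [wQ wz wpt]] := @ssegs_avoid_subsingleton z (range pt) zQ.
    move=> X Y [zf [f _ fX]] [zg [g _ gY]]; subst X Y; congr pt.
    by case: dz => dz; have := dz _ _ zf zg; apply: pt_agree; [left|right].
  exists w; split=> //; first exact: subset_trans zy.
  split; first by case: dz => dz; [left|right]; exact: decided_sub dz.
  by move=> f wf; suff : (w `&` range pt) (pt f) by rewrite wpt.
- move=> f; split=> //; last by apply: sub_almost_sub; exact: ptB.
  by apply: sub_almost_sub => k; left.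
- by move=> f g fg; apply: (pt_agree f g E); [left|rewrite fg; exists 0].
- by move=> y f [].
- move=> f; split=> //; apply: sseg_sub; apply: sub_almost_sub => k.
    by left.
  by move=> [/loB//|[]].
- move=> f g [X [/partE fX /partE gX]]; apply: (pt_agree f g E); first by left.
  exact: agree_on_trans (agree_on_sym gX).
- move=> y f g [dy _] [z zQ zyf] [w wQ wyg].
  (* [z] is decided on [E] because it lies in [part f], so [y], which contains [z], cannot be
     decided off [E]. *)
  have dE : decided E y.
    case: dy => // dy; case: (@ssegs_undecided E z) => //.
      move=> X Y /zyf[_ /partE fX] /zyf[_ /partE fY].
      exact: agree_on_trans (agree_on_sym fX) fY.
    by apply: decided_sub dy => X /zyf[].
  have [Z zZ] := ssegs_nonempty zQ; have [W wW] := ssegs_nonempty wQ.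
  have [[yZ fZ] [yW gW]] := (zyf _ zZ, wyg _ wW).
  apply: (pt_agree f g E); first by left.
  apply: agree_on_trans (partE _ _ fZ) (agree_on_trans (dE _ _ yZ yW) _).
  exact: agree_on_sym (partE _ _ gW).
Qed.

(** * The ideal (v0) and the generated topology *)

Lemma ssegs_infsetsT : ssegs infsets.
Proof.
exists set0, setT; split.
  by split=> //; rewrite setD0; exact: infinite_nat.
apply/seteqP; split=> X; last by case.
by move=> infX; split=> //; exact: sub_almost_sub.
Qed.

Lemma v0_sub (S S' : set (set nat)) : v0 S' -> S `<=` S' -> v0 S.
Proof.
move=> S'v0 SS'; apply: v0_intro; first exact: subset_trans S'v0.1.
move=> x xQ; have [y [yQ yx yS']] := v0_avoid S'v0 xQ.
by exists y; split=> //; apply/seteqP; split=> // X [yX /SS' SX]; rewrite -yS'.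
Qed.

Lemma v0_setU (S S' : set (set nat)) : v0 S -> v0 S' -> v0 (S `|` S').
Proof.
move=> Sv0 S'v0; apply: v0_intro; first by move=> X [/Sv0.1|/S'v0.1].
move=> x xQ; have [y [yQ yx yS]] := v0_avoid Sv0 xQ.
have [z [zQ zy zS']] := v0_avoid S'v0 yQ.
exists z; split=> //; first exact: subset_trans yx.
rewrite setIUr zS' setU0; apply/seteqP; split=> // X [/zy yX SX].
by rewrite -yS.
Qed.

Lemma v0_set1 (X : set nat) : infinite_set X -> v0 [set X].
Proof.
move=> infX; apply: v0_intro => [_ ->//|x xQ].
by apply: ssegs_avoid_subsingleton => // _ _ [_ ->] [_ ->].
Qed.

Lemma ground_v0 : ground v0 = infsets.
Proof.
apply/seteqP; split=> [X [S [Sinf _] /Sinf //]|X infX].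
by exists [set X] => //; exact: v0_set1.
Qed.

Lemma v0_proper : proper_ideal v0.
Proof.
split.
- by apply: v0_intro => // x xQ; exists x; split=> //; rewrite setI0.
- by move=> S S'; exact: v0_sub.
- exact: v0_setU.
- rewrite ground_v0 => /v0_avoid/(_ ssegs_infsetsT)[y [yQ _ yT]].
  have [X yX] := ssegs_nonempty yQ.
  have : (y `&` infsets) X by split=> //; exact: ssegs_infsets yX.
  by rewrite yT.
Qed.

Section GeneratedSpace.
Variables (T : choiceType) (E : set T) (G : set (set T)).

Definition trace (h : set T) : set (generated_space E G) :=
  [set x | h (val (x : set_type E))].

Lemma open_trace (h : set T) : G h -> open (trace h).
Proof.
move=> Gh; exists [set trace h]; last by rewrite bigcup_set1.
by move=> _ ->; exact: finI_from1.
Qed.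

Lemma open_generatedP (A : set (generated_space E G)) x : open A -> A x ->
  exists s : seq (set T), [/\ forall h, h \in s -> G h /\ h (val (x : set_type E)) &
    forall y : generated_space E G,
      (forall h, h \in s -> h (val (y : set_type E))) -> A y].
Proof.
move=> [F FG <-] [B FB Bx]; have [D DG DB] := FG _ FB; change (B x) in Bx.
exists (finmap.enum_fset D); split=> [h hD|y yD].
  split; first by have := DG _ hD; rewrite inE.
  by move: Bx; rewrite -DB; exact.
by exists B => //; change (B y); rewrite -DB => h /yD.
Qed.

End GeneratedSpace.

(** Members of [H] that meet are nested, so a nonempty finite intersection of them is a member or
    the whole space; by density every nonempty open set contains a member of [H]. Hence being
    nowhere dense means that every *-segment contains one missing the set. *)
Lemma nowhere_dense_v0 (H : set (set (set nat))) :
  H `<=` ssegs ->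
  (forall x y, H x -> H y -> x `&` y !=set0 -> x `<=` y \/ y `<=` x) ->
  (forall x, ssegs x -> exists2 h, H h & h `<=` x) ->
  nowhere_dense_ideal (ground v0) H = v0.
Proof.
move=> HQ Hcmp Hdense; set E := ground v0.
pose sp := generated_space E H; pose tr : set (set nat) -> set sp := @trace _ E H.
have otr h : H h -> open (tr h) by exact: open_trace.
have pointE X : infinite_set X -> exists x : sp, val (x : set_type E) = X.
  move=> infX; have EX : E X by rewrite /E ground_v0.
  by exists (exist _ X (mem_set EX)).
have base (A : set sp) x : open A -> A x -> exists2 h, H h & tr h `<=` A.
  move=> oA Ax; have [s [sH sA]] := open_generatedP oA Ax.
  set X := val (x : set_type E) in sH.
  have infX : infinite_set X.
    have : E X by exact/set_mem/(valP (x : set_type E)).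
    by rewrite /E ground_v0.
  have [q [qH [qX qs]]] : exists q, (q = infsets \/ H q) /\
      (q X /\ forall h, h \in s -> q `<=` h).
    elim: s sH {sA} => [|h s IH] sH; first by exists infsets; split; [left|].
    have [|q [qH [qX qs]]] := IH; first by move=> k ks; apply: sH; rewrite inE ks orbT.
    have [Hh hX] := sH h (mem_head _ _).
    have [qh|nqh] := pselect (q `<=` h).
      by exists q; do 2!split=> //; move=> k; rewrite inE => /predU1P[->|/qs].
    have hq : h `<=` q.
      case: qH => [->|Hq]; first exact/ssegs_infsets/HQ.
      by case: (Hcmp q h Hq Hh _) => //; exists X.
    exists h; split; first by right.
    split=> // k; rewrite inE => /predU1P[->//|/qs]; exact: subset_trans.
  have [h Hh hq] : exists2 h, H h & h `<=` q.
    by apply: Hdense; case: qH => [->|/HQ//]; exact: ssegs_infsetsT.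
  by exists h => // y hy; apply: sA => k /qs; apply; exact: hq.
have trace_nonempty h : H h -> exists y, tr h y.
  move=> /HQ hQ; have [X hX] := ssegs_nonempty hQ.
  by have [y yX] := pointE X (ssegs_infsets hQ hX); exists y; rewrite /tr /trace /= yX.
apply/seteqP; split=> S.
  move=> [SE nwd]; apply: v0_intro; first by rewrite -ground_v0.
  move=> x /Hdense[h Hh hx]; have [y0 hy0] := trace_nonempty h Hh.
  (* The closure of [S] has empty interior, so it does not cover [h]; a neighbourhood of [y] missing
     [S] then contains the required member of [H]. *)
  have [y [hy]] : exists y : sp, tr h y /\ ~ closure (tr S) y.
    apply: contrapT => ny.
    have : interior (closure (tr S)) y0.
      apply: (@filterS _ _ _ (tr h)); last first.
        by apply: open_nbhs_nbhs; split=> //; exact: otr.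
      by move=> y hy; apply: contrapT => nSy; apply: ny; exists y.
    by rewrite nwd.
  move=> /existsNP[B /not_implyP[yB SB]].
  move: (yB); rewrite nbhsE => -[U [oU Uy] UB].
  have [|h' Hh' h'U] := base (U `&` tr h) y (openI oU (otr _ Hh)); first by split.
  exists h'; split; first exact: HQ.
    move=> X h'X; have [z zX] := pointE X (ssegs_infsets (HQ _ Hh') h'X).
    by apply: hx; have [] := h'U z; rewrite /tr /trace /= zX.
  apply/seteqP; split=> // X [h'X SX].
  have [z zX] := pointE X (ssegs_infsets (HQ _ Hh') h'X).
  apply: SB; exists z; split; first by rewrite /tr /trace /= zX.
  by apply: UB; have [] := h'U z; rewrite /tr /trace /= zX.
move=> Sv0; split; first by rewrite /E ground_v0; exact: Sv0.1.
apply/seteqP; split=> // y Sy.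
have [h Hh hS] := base _ y (@open_interior _ (closure (tr S))) Sy.
have [x [xQ xh xS]] := v0_avoid Sv0 (HQ _ Hh).
have [h' Hh' h'x] := Hdense x xQ.
have [z zh'] := trace_nonempty h' Hh'.
have zS : closure (tr S) z.
  by apply: interior_subset; apply: hS; exact/xh/h'x.
have [|w [Sw h'w]] := zS (tr h').
  by apply: open_nbhs_nbhs; split=> //; exact: otr.
have : (x `&` S) (val (w : set_type E)) by split=> //; exact: h'x.
by rewrite xS.
Qed.

(** * Well-orders and initial ordinals *)

Section WellOrder.
Variables (T : Type) (R : rel T).
Hypothesis wo : well_order R.

Lemma well_order_refl : reflexive R.
Proof.
by move=> x; exact: (@wo_chain_reflexive {classic T} R predT (fun A _ => @wo A) x isT).
Qed.

Lemma well_order_antisym : antisymmetric R.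
Proof.
move=> x y.
exact: (@wo_chain_antisymmetric {classic T} R predT (fun A _ => @wo A) x y isT isT).
Qed.

Lemma well_order_total : total R.
Proof.
by move=> x y; exact: (@wo_chainW {classic T} R predT (fun A _ => @wo A) x y isT isT).
Qed.

Lemma well_order_min (A : set T) : A !=set0 ->
  exists2 m, A m & forall x, A x -> R m x.
Proof.
move=> [x Ax]; have [|m [[Am mmin] _]] := wo (A := fun x => `[< A x >]).
  by exists x; apply/asboolP.
exists m; first exact/asboolP.
by move=> y Ay; apply: mmin; apply/asboolP.
Qed.

Lemma below_wf : well_founded (fun b a => below R a b).
Proof.
move=> a; apply: contrapT => na.
have [m nm mmin] := @well_order_min [set x | ~ Acc (fun b a => below R a b) x]
  (ex_intro _ a na).
apply: nm; split=> b [bm nbm]; apply: contrapT => /mmin mb.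
by apply: nbm; apply: well_order_antisym; rewrite bm mb.
Qed.

Lemma not_below (a b : T) : ~ below R a b -> R a b.
Proof.
move=> nba; case/orP: (well_order_total a b) => // ba.
have [->|ne] := pselect (b = a); first exact: well_order_refl.
by case: nba.
Qed.

Lemma below_trichotomy (a b : T) : [\/ below R a b, a = b | below R b a].
Proof.
have [ab|nab] := pselect (a = b); first by constructor 2.
case/orP: (well_order_total a b) => ab; [constructor 3|constructor 1] => //.
by split=> // /esym.
Qed.

(* [phi a f b] reads: [b] is an admissible value at [a], given the values of [f]
   below [a]. *)
Lemma well_order_rec (B : Type) (b0 : B) (phi : T -> (T -> B) -> B -> Prop) :
  (forall a f g b, (forall c, below R a c -> f c = g c) -> phi a f b -> phi a g b) ->
  (forall a f, exists b, phi a f b) -> exists F, forall a, phi a F (F a).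
Proof.
move=> phi_ext phi_ex.
have /choice[next nextP] : forall af : T * (T -> B), exists b, phi af.1 af.2 b.
  by move=> af; exact: phi_ex.
pose cut a (h : forall c, below R a c -> B) c :=
  if pselect (below R a c) is left ca then h c ca else b0.
pose F := Fix below_wf (fun=> B) (fun a h => next (a, cut a h)).
have FE a : F a = next (a, cut a (fun c _ => F c)).
  rewrite /F Fix_eq // => x f g fg; congr (next (_, _)).
  apply/funext => c; rewrite /cut; case: pselect => // p; exact: fg.
exists F => a; rewrite [X in phi _ _ X]FE.
apply: (phi_ext _ (cut a (fun c _ => F c))); last exact: nextP (a, _).
move=> c ca; by rewrite /cut; case: pselect.
Qed.

End WellOrder.

Lemma card_le_injP (T U : Type) (A : set T) (B : set U) (f : T -> U) :
  {in A &, injective f} -> (forall x, A x -> B (f x)) -> A #<= B.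
Proof.
move=> finj fAB; rewrite -(card_le_eql (inj_card_eq finj)).
by apply: subset_card_le => _ [x Ax <-]; exact: fAB.
Qed.

Lemma card_le_rel (T U : Type) (A : set T) (B : set U) (r : T -> U -> Prop) :
  (forall x, A x -> exists2 y, B y & r x y) ->
  (forall x x' y, A x -> A x' -> B y -> r x y -> r x' y -> x = x') -> A #<= B.
Proof.
move=> rex rinj; have [[u]|nU] := pselect (inhabited U); last first.
  suff -> : A = set0 by exact: card_ge0.
  by apply/seteqP; split=> // x /rex[y]; case: nU.
have /choice[f fP] : forall x, exists y, A x -> B y /\ r x y.
  move=> x; have [/rex[y]|nAx] := pselect (A x); last by exists u.
  by exists y.
apply: (@card_le_injP _ _ _ _ f); last by move=> x /fP[].
move=> x x' /set_mem Ax /set_mem Ax' fE.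
have [[Bx rx] [_ rx']] := (fP _ Ax, fP _ Ax').
by apply: rinj rx _; rewrite // fE.
Qed.

(** If [X] injects into a proper initial segment of a well-order, the shortest such segment has the
    size of [X], and its own proper initial segments do not. *)
Lemma initial_well_order (X : Type) : exists (T : Type) (R : rel T),
  [/\ well_order R, [set: T] #<= [set: X], [set: X] #<= [set: T] &
    forall t, ~ ([set: X] #<= below R t)].
Proof.
have [R wo] := @well_ordering_principle {classic X}.
have [small|] := pselect (forall x : X, ~ ([set: X] #<= below R x)).
  by exists X, R.
move=> /existsNP[a /contrapT aX].
have [m mX mmin] := well_order_min wo (ex_intro (fun x => [set: X] #<= below R x) a aX).
pose T := {x : X | below R m x}; pose S : rel T := fun x y => R (sval x) (sval y).
have sval_inj' (x y : T) : sval x = sval y -> x = y.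
  by case: x y => [x px] [y py] /= xy; subst y; rewrite (Prop_irrelevance px py).
exists T, S; split.
- apply: antisymmetric_well_order.
    by move=> x y /(well_order_antisym wo) /sval_inj'.
  move=> A [x Ax].
  have [_ [z Az <-] zmin] := well_order_min wo
    (ex_intro [set y : X | exists2 z : T, z \in A & sval z = y] _ (ex_intro2 _ _ x Ax erefl)).
  by exists z; split=> // y Ay; apply: zmin; exists y.
- by apply: (@card_le_injP _ _ _ _ sval) => // x y _ _; exact: sval_inj'.
- apply: card_le_trans mX _; apply: (@card_le_rel _ _ _ _ (fun x t => x = sval t)).
    by move=> x mx; exists (exist _ x mx).
  by move=> x x' y _ _ _ -> ->.
- move=> t tX; have [tm ntm] := svalP t; apply: ntm.
  apply: (well_order_antisym wo); rewrite tm /=; apply: mmin.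
  apply: card_le_trans tX _; apply: (@card_le_injP _ _ _ _ sval).
    by move=> x y _ _; exact: sval_inj'.
  by move=> x [xt nxt]; split=> // /sval_inj'.
Qed.

(** Regularity of omega_1: an unbounded countable family would cover it by countably many countable
    initial segments. *)
Lemma omega1_bounded (I : countType) (h : I -> omega1_sort) :
  exists c, forall i, below omega1_le c (h i).
Proof.
apply: contrapT => nc; apply: omega1_uncountable.
have cov c : exists i, omega1_le c (h i).
  apply: contrapT => ni; apply: nc; exists c => i; apply: contrapT => nb.
  by apply: ni; exists i; exact: (not_below omega1_well_order).
pose F (ib : I * bool) := if ib.2 then below omega1_le (h ib.1) else [set h ib.1].
apply: (@sub_countable _ _ _ (\bigcup_(ib in [set: I * bool]) F ib)).
  apply: subset_card_le => c _; have [i ci] := cov c.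
  have [->|ne] := pselect (c = h i); first by exists (i, false).
  by exists (i, true).
apply: bigcup_countable => [|[i []] _]; first exact: countableP.
  exact: omega1_below_countable.
exact: countable1.
Qed.

(** Running through an enumeration of [C] and keeping the smaller of the current set and the next
    one turns the chain into a decreasing sequence starting at [infsets]. *)
Lemma ssegs_chain_lower_bound (C : set (set (set nat))) :
  C `<=` ssegs -> countable C -> total_on C subset ->
  exists2 y, ssegs y & forall c, C c -> y `<=` c.
Proof.
move=> CQ /countable_injP[g]; set h := (g : _ -> nat) => hinj Ctot.
have step n y : exists z, (ssegs y /\ (y = infsets \/ C y)) ->
    [/\ ssegs z /\ (z = infsets \/ C z), z `<=` y &
      forall c, C c -> h c = n -> z `<=` c].
  have [[c [Cc hc]]|nc] := pselect (exists c, C c /\ h c = n); last first.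
    by exists y => -[? ?]; split=> // c ? ?; case: nc; exists c.
  have uniq c' : C c' -> h c' = n -> c' = c.
    by move=> Cc' hc'; apply: hinj; rewrite ?inE // hc'.
  have [cy|ncy] := pselect (c `<=` y).
    exists c => _; split=> // [|c' Cc' hc']; first by split; [exact: CQ|right].
    by rewrite (uniq c').
  exists y => -[yQ yC]; split=> // c' Cc' hc'; rewrite (uniq c') //.
  case: yC => [yE|Cy]; last by case: (Ctot _ _ Cc Cy).
  by case: ncy; rewrite yE; exact/ssegs_infsets/CQ.
have /choice[next nextP] : forall ny : nat * set (set nat), exists z,
    (ssegs ny.2 /\ (ny.2 = infsets \/ C ny.2)) ->
    [/\ ssegs z /\ (z = infsets \/ C z), z `<=` ny.2 &
      forall c, C c -> h c = ny.1 -> z `<=` c].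
  by move=> [n y]; exact: step.
pose y := fix y n := if n is m.+1 then next (m, y m) else infsets.
have yP n : ssegs (y n) /\ (y n = infsets \/ C (y n)).
  elim: n => [|n IH] /=; first by split; [exact: ssegs_infsetsT|left].
  by have [] := nextP (n, y n) IH.
have [w wQ wy] : exists2 w, ssegs w & forall n, w `<=` y n.
  apply: ssegs_lower_bound => n; first exact: (yP n).1.
  by have [] := nextP (n, y n) (yP n).
exists w => // c Cc; apply: subset_trans (wy (h c).+1) _.
by have [_ _ /(_ c Cc erefl)] := nextP (h c, y (h c)) (yP _).
Qed.

(** * The base matrix *)

Section Matrix.
Variables (T : Type) (R : rel T).
Hypothesis R_wo : well_order R.
Hypothesis R_initial : forall t, ~ ([set: set nat] #<= below R t).
Hypothesis T_le : [set: T] #<= [set: set nat].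
Variable enum : T -> set (set nat).
Hypothesis enum_onto : forall x, ssegs x -> exists t, enum t = x.

(** A greedy choice of pairwise disjoint members of [D]; [set0] records a step at which every
    candidate below [enum t] meets an earlier choice. *)
Definition level_enum (D : set (set (set nat))) (a : T -> set (set nat)) : Prop :=
  forall t,
    [/\ D (a t), a t `<=` enum t & forall s, below R t s -> a s `&` a t = set0] \/
    a t = set0 /\
      forall x, D x -> x `<=` enum t -> exists2 s, below R t s & a s `&` x !=set0.

Lemma level_enum_exists (D : set (set (set nat))) : exists a, level_enum D a.
Proof.
apply: (well_order_rec R_wo set0 (phi := fun t a at_ =>
  [/\ D at_, at_ `<=` enum t & forall s, below R t s -> a s `&` at_ = set0] \/
  at_ = set0 /\
    forall x, D x -> x `<=` enum t -> exists2 s, below R t s & a s `&` x !=set0)).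
- move=> t a a' y aa' [[Dy yt ya]|[y0 no]]; [left|right]; split=> //.
    by move=> s st; rewrite -aa' // ya.
  by move=> x Dx xt; have [s st ax] := no x Dx xt; exists s => //; rewrite -aa'.
- move=> t a.
  have [[x [Dx xt xa]]|nx] := pselect (exists x,
    [/\ D x, x `<=` enum t & forall s, below R t s -> a s `&` x = set0]).
    by exists x; left.
  exists set0; right; split=> // x Dx xt; apply: contrapT => ns; apply: nx.
  exists x; split=> // s st; apply/eqP; apply: contrapT => /negP/set0P ax.
  by apply: ns; exists s.
Qed.

(* If the choice failed, every candidate [r f] would be met by one of the previous
   choices, which are too few since each meets at most one candidate. *)
Lemma level_enum_hit (D : set (set (set nat))) (a : T -> set (set nat)) (t : T)
    (r : set nat -> set (set nat)) : level_enum D a ->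
  (forall f, D (r f) /\ r f `<=` enum t) ->
  (forall s f g, below R t s -> D (a s) ->
     a s `&` r f !=set0 -> a s `&` r g !=set0 -> f = g) ->
  D (a t) /\ a t `<=` enum t.
Proof.
move=> aD rD sep; have [[]//|[_ no]] := aD t; case: (@R_initial t).
apply: (@card_le_rel _ _ _ _ (fun f s => a s `&` r f !=set0)).
  by move=> f _; have [Dr rt] := rD f; exact: no.
move=> f g s _ _ st af ag; apply: (sep s) => //.
have [[]//|[a0 _]] := aD s; by case: af => X []; rewrite a0.
Qed.

Variable S : omega1_sort -> set (set nat).
Hypothesis S_v0 : forall al, v0 (S al).
Hypothesis S_cover : forall X, infinite_set X -> exists al, S al X.

Variable d : set (set nat) -> set (set (set nat)).
Variable pt : set (set nat) -> set nat -> set nat.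
Variable part : set (set nat) -> set nat -> set (set nat).
Hypothesis d_splitter : forall x, ssegs x -> splitter x (d x) (pt x) (part x).

Local Notation lt b a := (below omega1_le a b).

Definition nodes (a : T -> set (set nat)) : set (set (set nat)) :=
  [set x | x !=set0 /\ exists t, a t = x].

(** The condition [d infsets x] treats the whole space as a node above all levels, so that whole
    levels can be counted in the same way as the nodes inside a given node. *)
Definition admissible (al : omega1_sort) (a : omega1_sort -> T -> set (set nat)) :
    set (set (set nat)) :=
  [set x | [/\ ssegs x, x `&` S al = set0, d infsets x &
    forall be, lt be al ->
      exists q, [/\ nodes (a be) q, x `<=` q & d q x]]].

Lemma levels_exist : exists a : omega1_sort -> T -> set (set nat),
  forall al, level_enum (admissible al a) (a al).
Proof.
apply: (well_order_rec omega1_well_order (fun=> set0)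
  (phi := fun al a b => level_enum (admissible al a) b)).
  move=> al a a' b aa'; congr level_enum.
  apply/seteqP; split=> x [xQ xS dx xq]; split=> // be bea.
    by rewrite -aa'//; exact: xq.
  by rewrite aa'//; exact: xq.
by move=> al a; exact: level_enum_exists.
Qed.

Variable a : omega1_sort -> T -> set (set nat).
Hypothesis a_level : forall al, level_enum (admissible al a) (a al).

Let P al := nodes (a al).

Lemma node_admissible al x : P al x -> admissible al a x.
Proof.
move=> [x0 [t tx]]; have [[]|[ax0 _]] := a_level al t; first by rewrite tx.
by move: x0; rewrite -tx ax0 => -[].
Qed.

Lemma node_ssegs al x : P al x -> ssegs x.
Proof. by case/node_admissible. Qed.

Lemma node_eq al x y : P al x -> P al y -> x `&` y !=set0 -> x = y.
Proof.
have key s t : below R t s -> a al s `&` a al t = set0.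
  by move=> st; have [[_ _ /(_ s st)//]|[-> _]] := a_level al t; rewrite setI0.
move=> [_ [s <-]] [_ [t <-]] [X aX].
case: (below_trichotomy R_wo s t) => [ts|->//|st].
  by move: aX; rewrite setIC key.
by move: aX; rewrite key.
Qed.

Lemma node_refine al be x : lt be al -> P al x ->
  exists q, [/\ P be q, x `<=` q & d q x].
Proof. by move=> ba /node_admissible[_ _ _]; apply. Qed.

Lemma node_sub al be x y : lt be al -> P al x -> P be y -> x `&` y !=set0 ->
  x `<=` y /\ d y x.
Proof.
move=> ba xP yP [X [xX yX]]; have [q [qP xq dq]] := node_refine ba xP.
suff <- : q = y by [].
by apply: node_eq qP yP _; exists X; split=> //; exact: xq.
Qed.

Lemma node_comparable al be x y : P al x -> P be y -> x `&` y !=set0 ->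
  x `<=` y \/ y `<=` x.
Proof.
move=> xP yP xy; case: (below_trichotomy omega1_well_order al be) => [ba|E|ab].
- by left; exact: (node_sub ba xP yP xy).1.
- by left; rewrite E in xP; rewrite (node_eq xP yP xy).
- by right; apply: (node_sub ab yP xP _).1; rewrite setIC.
Qed.

(** * Predensity of the levels and density of the matrix *)

Definition predense (F : set (set (set nat))) : Prop :=
  forall x, ssegs x -> exists2 q, F q & compatible x q.

(** Only countably many levels precede [al]: going below a node [q] of each in turn, and into [d q],
    gives a decreasing sequence, whose lower bound is shrunk further to enter [d infsets] and to
    miss [S al]. *)
Lemma admissible_dense_of_predense al : (forall be, lt be al -> predense (P be)) ->
  forall x, ssegs x -> exists2 y, admissible al a y & y `<=` x.
Proof.
move=> pd x xQ.
have /countable_injP[g] := omega1_below_countable al; set h := (g : _ -> nat) => hinj.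
have /choice[next nextP] : forall ny : nat * set (set nat), exists z, ssegs ny.2 ->
    [/\ ssegs z, z `<=` ny.2 & forall be, lt be al -> h be = ny.1 ->
      exists q, [/\ P be q, z `<=` q & d q z]].
  move=> [n y] /=; have [yQ|nyQ] := pselect (ssegs y); last by exists set0.
  have [[be [bal hb]]|nb] := pselect (exists be, lt be al /\ h be = n); last first.
    by exists y => _; split=> // be ? ?; case: nb; exists be.
  have [q qP [z zQ zyq]] := pd be bal y yQ.
  have [w [wQ wz dw]] := splitter_dense (d_splitter (node_ssegs qP)) zQ.
  exists w => _; split=> // [X /wz/zyq[]//|be' bal' hb'].
  have -> : be' = be by apply: hinj; rewrite ?inE // hb'.
  by exists q; split=> // X /wz/zyq[].
pose y := fix y n := if n is m.+1 then next (m, y m) else x.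
have yQ n : ssegs (y n) by elim: n => //= n IH; have [] := nextP (n, y n) IH.
have [w wQ wy] : exists2 w, ssegs w & forall n, w `<=` y n.
  apply: ssegs_lower_bound => // n.
  by have [] := nextP (n, y n) (yQ n).
have [u [uQ uw du]] := splitter_dense (d_splitter ssegs_infsetsT) wQ.
have [v [vQ vu vS]] := v0_avoid (S_v0 al) uQ.
have vy n : v `<=` y n by move=> X /vu/uw/wy.
exists v; last exact: vy 0.
split=> //; first exact: (splitter_down (d_splitter ssegs_infsetsT)) du.
move=> be bal; have [_ _ /(_ be bal erefl)[q [qP yq dq]]] := nextP (h be, y (h be)) (yQ _).
have vz : v `<=` next (h be, y (h be)) := vy (h be).+1.
exists q; split=> //; first exact: subset_trans yq.
exact: (splitter_down (d_splitter (node_ssegs qP))) dq.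
Qed.

Lemma admissible_sub al x y : admissible al a x -> ssegs y -> y `<=` x ->
  admissible al a y.
Proof.
move=> [_ xS dx xq] yQ yx; split=> //.
- by apply/seteqP; split=> // X [/yx xX SX]; rewrite -xS.
- exact: (splitter_down (d_splitter ssegs_infsetsT)) dx.
- move=> be /xq[q [qP xq' dq]]; exists q; split=> //; first exact: subset_trans xq'.
  exact: (splitter_down (d_splitter (node_ssegs qP))) dq.
Qed.

(** Let [y] be admissible below [x]. If [y] is incompatible with all choices of the level, each
    choice meets [y] in at most one class modulo finite sets, hence meets at most one [part y f]; so
    the choice made for [y] itself succeeds and lies in [y]. *)
Lemma node_predense al : predense (P al).
Proof.
elim/(well_founded_ind (below_wf omega1_well_order)): al => al IH x xQ.
have [y yD yx] := admissible_dense_of_predense IH xQ.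
have [yQ _ _ _] := yD; have sp := d_splitter yQ.
have [t ty] := enum_onto yQ.
have nonempty_node s : admissible al a (a al s) -> P al (a al s).
  by move=> [/ssegs_nonempty ? _ _ _]; split=> //; exists s.
have [[s [sD [z zQ zy]]]|ncomp] := pselect (exists s,
    admissible al a (a al s) /\ compatible y (a al s)).
  exists (a al s); first exact: nonempty_node.
  by exists z => // X /zy[/yx].
have [] := @level_enum_hit _ _ t (part y) (a_level al).
- move=> f; have [fQ fy] := splitter_part sp f; rewrite ty; split=> //.
  exact: admissible_sub yD fQ fy.
- move=> s f g _ sD [X [aX fX]] [Y [aY gY]].
  have nc : ~ compatible y (a al s) by move=> c; apply: ncomp; exists s.
  have [sQ _ _ _] := sD.
  have yX := (splitter_part sp f).2 _ fX; have yY := (splitter_part sp g).2 _ gY.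
  have eq := incompatible_almost_sub yQ sQ nc.
  apply: (splitter_part_disjoint sp); exists Y; split=> //.
  by apply: ssegs_almost_eq (splitter_part sp f).1 _ _ fX; exact: eq.
- rewrite ty => tD ay; exists (a al t); first exact: nonempty_node.
  by have [tQ _ _ _] := tD; exists (a al t) => // X aX; split=> //; exact/yx/ay.
Qed.

Lemma admissible_dense al x : ssegs x -> exists2 y, admissible al a y & y `<=` x.
Proof. by apply: admissible_dense_of_predense => be _; exact: node_predense. Qed.

(* If every level had a single member compatible with [x], then [x] would be
   contained in all these members, hence disjoint from all the [S al]. *)
Lemma node_split x : ssegs x -> exists al (y q : bool -> set (set nat)),
  injective q /\
  forall b, [/\ ssegs (y b), y b `<=` x, y b `<=` q b & P al (q b)].
Proof.
move=> xQ; apply: contrapT => nsplit.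
have one al q q' : P al q -> P al q' -> compatible x q -> compatible x q' -> q = q'.
  move=> qP qP' [z zQ zq] [z' zQ' zq']; apply: contrapT => nqq'; apply: nsplit.
  exists al, (fun b => if b then z else z'), (fun b => if b then q else q').
  split; first by case=> [] [] // E; case: nqq'.
  by case; split=> //; [move=> X /zq[]|move=> X /zq[]|move=> X /zq'[]|move=> X /zq'[]].
have [X xX] := ssegs_nonempty xQ.
have [al SX] := S_cover (ssegs_infsets xQ xX).
have [q qP xq] := node_predense al xQ.
(* If [x] is not inside [q], a part of [x] disjoint from [q] is compatible with a second node of the
   same level. *)
have [xsub|/(ssegs_separative xQ (node_ssegs qP))[z [zQ zx zq]]] := pselect (x `<=` q).
  have [_ qS _ _] := node_admissible qP.
  have : (q `&` S al) X by split=> //; exact: xsub.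
  by rewrite qS.
have [q' qP' [w wQ wzq']] := node_predense al zQ.
have E : q = q'.
  apply: one qP qP' xq _; exists w => // Y /wzq'[/zx]; by split.
have [Y wY] := ssegs_nonempty wQ; have [zY qY] := wzq' _ wY.
have : (z `&` q) Y by split=> //; rewrite E.
by rewrite zq.
Qed.

(** The latest bit stands in front, so that the tail of the list is the parent in the binary
    tree. *)
Fixpoint branch (f : set nat) (n : nat) : seq bool :=
  if n is m.+1 then `[< f m >] :: branch f m else [::].

Lemma branch_inj f g : (forall n, branch f n = branch g n) -> f = g.
Proof.
move=> fg; apply/funext => n; have [fgn _] := fg n.+1.
by apply/propext; split=> /asboolP; [rewrite fgn|rewrite -fgn] => /asboolP.
Qed.

Lemma node_dense x : ssegs x -> exists al q, P al q /\ q `<=` x.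
Proof.
move=> xQ.
have /choice[al /choice[y /choice[q split_]]] : forall x, exists al (y q : bool -> set (set nat)),
    ssegs x -> injective q /\
    forall b, [/\ ssegs (y b), y b `<=` x, y b `<=` q b & P al (q b)].
  move=> w; have [/node_split[al [y [q ?]]]|nw] := pselect (ssegs w).
    by exists al, y, q.
  by have [al _] := S_cover infinite_nat; exists al, (fun=> set0), (fun=> set0).
pose node := fix node s := if s is b :: s' then y (node s') b else x.
have nodeQ s : ssegs (node s).
  by elim: s => //= b s /split_[_ /(_ b)[]].
(* The tree has countably many vertices, so some level [ga] lies above all the levels at which they
   split. *)
have [ga gaP] := omega1_bounded (fun s => al (node s)).
have /choice[r rP] : forall f, exists r, admissible ga a r /\
    forall n, r `<=` node (branch f n).
  move=> f; have [|w wQ wn] := @ssegs_lower_bound (fun n => node (branch f n)) (fun n => nodeQ _).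
    by move=> n /=; have [_ /(_ `[< f n >])[]] := split_ _ (nodeQ (branch f n)).
  by have [v vD vw] := admissible_dense ga wQ; exists v; split=> // n X /vw/wn.
have [t tx] := enum_onto xQ.
have [] := @level_enum_hit _ _ t r (a_level ga).
- by move=> f; have [rD rn] := rP f; rewrite tx; split=> //; exact: (rn 0).
(* The choice at [s] lies in a single node [u] of the level splitting [branch f n]; meeting both
   [r f] and [r g] forces the same next bit. *)
- move=> s f g _ [_ _ _ sq] [X [aX fX]] [Y [aY gY]].
  apply: branch_inj; elim=> // n IH /=; rewrite -IH; congr (_ :: _).
  have [u [uP su _]] := sq _ (gaP (branch f n)).
  have [qinj qP] := split_ _ (nodeQ (branch f n)).
  apply: qinj; transitivity u.
    have [_ _ yq qP'] := qP `[< f n >]; apply: node_eq qP' uP _.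
    exists X; split; last exact: su.
    by apply: yq; exact: (rP f).2 n.+1 X fX.
  have [_ _ yq qP'] := qP `[< g n >]; apply: node_eq uP qP' _.
  exists Y; split; first exact: su.
  by apply: yq; have := (rP g).2 n.+1 Y gY; rewrite /= -IH.
- rewrite tx => tD ax; exists ga, (a ga t); split=> //.
  by have [/ssegs_nonempty t0 _ _ _] := tD; split=> //; exists t.
Qed.

(** * Cardinalities and maximal chains *)

Lemma nodes_card_le al : P al #<= [set: set nat].
Proof.
apply: card_le_trans T_le.
apply: (@card_le_rel _ _ _ _ (fun x t => a al t = x)).
  by move=> x [_ [t tx]]; exists t.
by move=> x y t _ _ _ -> ->.
Qed.

(** By predensity each [part q f] is compatible with a node of the level; this node lies inside [q]
    and in [d q], so it serves only one [f]. *)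
Lemma nodes_inside al q : ssegs q ->
  (forall x, P al x -> x `&` q !=set0 -> x `<=` q /\ d q x) ->
  [set x | P al x /\ x `<=` q] #= [set: set nat].
Proof.
move=> qQ Pq; have sp := d_splitter qQ; apply: Cantor_Bernstein.
  by apply: card_le_trans (nodes_card_le al); apply: subset_card_le => x [].
have meets f x : compatible (part q f) x -> x `&` q !=set0.
  move=> [z /ssegs_nonempty[X zX] zqx]; have [fX xX] := zqx _ zX.
  by exists X; split=> //; exact: (splitter_part sp f).2.
apply: (@card_le_rel _ _ _ _ (fun f x => compatible (part q f) x)).
  move=> f _; have [x xP fx] := node_predense al (splitter_part sp f).1.
  by exists x => //; split=> //; exact: (Pq x xP (meets f x fx)).1.
have csym x y : compatible x y -> compatible y x.
  by move=> [z zQ zxy]; exists z => // X /zxy[].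
move=> f g x _ _ [xP _] fx gx.
apply: (splitter_one_part sp (Pq x xP (meets f x fx)).2); exact: csym.
Qed.

Lemma nodes_card al : P al #= [set: set nat].
Proof.
have -> : P al = [set x | P al x /\ x `<=` infsets].
  apply/seteqP; split=> x; last by case.
  by move=> xP; split=> //; exact/ssegs_infsets/node_ssegs/xP.
apply: nodes_inside; first exact: ssegs_infsetsT.
move=> x xP _; split; first exact/ssegs_infsets/node_ssegs/xP.
by have [] := node_admissible xP.
Qed.

Lemma nodes_inside_node al be y : lt be al -> P be y ->
  [set x | P al x /\ x `<=` y] #= [set: set nat].
Proof.
move=> ba yP; apply: nodes_inside; first exact: node_ssegs yP.
by move=> x xP xy; exact: node_sub ba xP yP xy.
Qed.

(** The points [pt x f] are left over: a later node meeting [x] is in [d x] and hence misses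
    them. *)
Lemma node_rest_card al be x : lt be al -> P be x ->
  x `\` matrix_level (P : omega1 -> _) al #= [set: set nat].
Proof.
move=> ba xP; have sp := d_splitter (node_ssegs xP).
apply: Cantor_Bernstein; first exact: card_leT.
apply: (@card_le_injP _ _ _ _ (pt x)).
  by move=> f g _ _; exact: (splitter_pt_inj sp).
move=> f _; split; first exact: splitter_pt sp f.
move=> [y yP yf]; apply: (splitter_avoid sp _ yf).
apply: (node_sub ba yP xP _).2.
by exists (pt x f); split=> //; exact: splitter_pt sp f.
Qed.

(** At the first missed level [m] the chain consists of one node for each earlier level, so it is
    countable and has a lower bound [y]; a node of level [m] compatible with [y] lies below the
    whole chain and could be added. *)
Lemma maximal_chain_meets (C : set (set (set nat))) (al : omega1_sort) :
  maximal_chain (matrix_union (P : omega1 -> _)) C -> C `&` P al !=set0.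
Proof.
move=> [CH Ctot Cmax].
have CQ x : C x -> exists be, P be x by move=> /CH[be _ bx]; exists be.
have Cne x : C x -> x !=set0 by move=> /CQ[be /node_ssegs/ssegs_nonempty].
have Cadd be q : P be q -> (forall c, C c -> c `<=` q \/ q `<=` c) -> C q.
  move=> qP qC; rewrite -(Cmax (q |` C)); first by left.
  - by move=> _ [->|/CH//]; exists be.
  - move=> x y [->|Cx] [->|Cy]; [by left|..|exact: Ctot].
      by case: (qC y Cy); [right|left].
    exact: qC.
  - by move=> c Cc; right.
apply: contrapT => nC.
have [m nm mmin] := well_order_min omega1_well_order
  (ex_intro (fun be => ~ (C `&` P be !=set0)) al nC).
have lev c : C c -> exists2 be, lt be m & P be c.
  move=> Cc; have [be bP] := CQ c Cc.
  case: (below_trichotomy omega1_well_order m be) => [bm|mb|mb].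
  - by exists be.
  - by case: nm; exists c; rewrite mb.
  (* A member beyond level [m] lies in a node [q] of level [m]; this [q] is comparable with the
     whole chain, so it belongs to it by maximality. *)
  have [q [qP cq _]] := node_refine mb bP; case: nm; exists q; split=> //.
  apply: (Cadd m) => // e Ce; have [ga eP] := CQ e Ce.
  have [ec|ce] := Ctot _ _ Ce Cc; first by left; exact: subset_trans cq.
  apply: node_comparable eP qP _; have [X cX] := Cne c Cc.
  by exists X; split; [exact: ce|exact: cq].
have /choice[ch chP] : forall be, exists c, lt be m -> C c /\ P be c.
  move=> be; have [bm|nbm] := pselect (lt be m); last by exists set0.
  have [[c [Cc bP]]|nb] := pselect (C `&` P be !=set0); first by exists c.
  case: bm => bm nbm; case: nbm.
  by apply: (well_order_antisym omega1_well_order); rewrite bm mmin.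
have Cch c : C c -> exists2 be, lt be m & c = ch be.
  move=> Cc; have [be bm bP] := lev c Cc; exists be => //.
  have [Cb bP'] := chP be bm; apply: node_eq bP bP' _.
  have [cb|bc] := Ctot _ _ Cc Cb.
    by have [X cX] := Cne c Cc; exists X; split=> //; exact: cb.
  by have [X cX] := Cne _ Cb; exists X; split=> //; exact: bc.
have [y yQ yC] : exists2 y, ssegs y & forall c, C c -> y `<=` c.
  apply: ssegs_chain_lower_bound => //; first by move=> c /CQ[be /node_ssegs].
  apply: (@sub_countable _ _ _ (ch @` below omega1_le m)).
    by apply: subset_card_le => c /Cch[be bm ->]; exists be.
  apply: sub_countable (omega1_below_countable m); exact: card_image_le.
have [q qP [z zQ zyq]] := node_predense m yQ.
have [X zX] := ssegs_nonempty zQ; have [yX qX] := zyq _ zX.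
apply: nm; exists q; split=> //; apply: (Cadd m) => // c Cc; right.
have [be bm bP] := lev c Cc; apply: (node_sub bm qP bP _).1.
by exists X; split=> //; exact: yC yX.
Qed.

Lemma nodes_ideal_type : ideal_type v0 continuum omega1 continuum.
Proof.
split; first exact: v0_proper.
exists (P : omega1 -> _); split; last split.
- split.
  + move=> al; split.
      by move=> x xP; rewrite ground_v0; exact/ssegs_infsets/node_ssegs/xP.
    by move=> x y xP yP; exact: node_eq xP yP.
  + move=> be al ba x xP.
    by have [q [qP xq _]] := node_refine ba xP; exists q.
  + move=> al; rewrite ground_v0; apply: v0_intro; first exact: subDsetl.
    move=> x xQ; have [q qP [z zQ zxq]] := node_predense al xQ.
    exists z; split=> //; first by move=> X /zxq[].
    apply/seteqP; split=> // X [/zxq[_ qX] [_ nX]]; apply: nX.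
    by exists q.
  + rewrite nowhere_dense_v0 //.
    * by move=> x [al _ /node_ssegs].
    * by move=> x y [al _ xP] [be _ yP]; exact: node_comparable xP yP.
    * move=> x /node_dense[al [q [qP qx]]]; exists q => //; by exists al.
- exact: nodes_card.
- by move=> be al ba x; exact: node_rest_card.
- by move=> be al ba y; exact: nodes_inside_node.
- by move=> C Cmax al; exact: maximal_chain_meets.
- apply/seteqP; split=> // X PX.
  have infX : infinite_set X.
    have [al _] := S_cover infinite_nat.
    by have [x xP xX] := PX al I; exact: ssegs_infsets (node_ssegs xP) _ xX.
  have [al SX] := S_cover infX; have [x xP xX] := PX al I.
  have [_ xS _ _] := node_admissible xP.
  have : (x `&` S al) X by [].
  by rewrite xS.
Qed.

End Matrix.

(** * Enumerating the *-segments and the covering family *)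

Lemma ssegs_card_le : ssegs #<= [set: set nat].
Proof.
pose code (AB : set nat * set nat) : set nat :=
  [set k | if odd k then AB.2 k./2 else AB.1 k./2].
apply: (@card_le_rel _ _ _ _ (fun x C => exists A B, x = sseg A B /\ code (A, B) = C)).
  by move=> _ [A [B [_ ->]]]; exists (code (A, B)) => //; exists A, B.
move=> _ _ C _ _ _ [A [B [-> <-]]] [A' [B' [-> E]]].
have at_ k : code (A', B') k = code (A, B) k by rewrite E.
have -> : A = A'.
  by apply/funext => k; have := at_ k.*2; rewrite /code /= odd_double doubleK.
have -> // : B = B'.
by apply/funext => k; have := at_ k.*2.+1; rewrite /code /= odd_double /= uphalf_double.
Qed.

Theorem theorem18 :
  cov_v0_eq omega1 -> ideal_type v0 continuum omega1 continuum.
Proof.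
move=> [[F [Fv0 Fcov Fomega1]] _].
have [T [R [R_wo T_le le_T R_init]]] := initial_well_order (set nat).
have /pcard_surjP[p0 p0surj] : ssegs #<= [set: T] := card_le_trans ssegs_card_le le_T.
have enum_onto x : ssegs x -> exists t, p0 t = x by move=> /p0surj[t _]; exists t.
have /pcard_surjP[S0 S0surj] : F #<= [set: omega1_sort].
  by move: Fomega1; rewrite card_eq_le => /andP[].
(* [S0] reaches all of [F] but may take values outside it; these are replaced by the empty set,
   which is in [v0]. *)
pose S al := if pselect (F (S0 al)) then S0 al else set0.
have S_v0 al : v0 (S al).
  rewrite /S; case: pselect => FS; first exact: Fv0.
  by have [] := v0_proper.
have S_cover X : infinite_set X -> exists al, S al X.
  move=> infX; have : (\bigcup_(A in F) A) X by rewrite Fcov.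
  move=> [A FA AX]; have [al _ alA] := S0surj _ FA; exists al.
  by rewrite /S alA; case: pselect.
have /choice[d /choice[pt /choice[part dP]]] : forall x, exists d pt part,
    ssegs x -> splitter x d pt part.
  move=> x; have [/splitter_exists[d [pt [part ?]]]|nx] := pselect (ssegs x).
    by exists d, pt, part.
  by exists set0, id, (fun=> set0).
have [a aP] := levels_exist R_wo p0 S d.
exact: (@nodes_ideal_type T R R_wo R_init T_le p0 enum_onto S S_v0 S_cover d pt part dP a aP).
Qed.
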